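(* Let $\Gamma=\sqcup_i\Gamma_i$ be a finite disjoint union of finite connected graphs of groups with trivial edge-groups and non-trivial (free) fundamental groups. For any $\phi\in\mathrm{Aut}(\Gamma)$ and for any open simplex $\Delta$ in $\mathcal O(\Gamma)$, the function $\lambda_\phi$ is quasi-convex on (Euclidean) segments of $\Delta$. Moreover, if $\overline{AB}$ is a segment of $\Delta$ with endpoints $A,B$ and $\lambda_\phi(A)>\lambda_\phi(B)$, then $\lambda_\phi$ (restricted to the segment) is not locally constant near $A$.
   Context: **Outer spaces.** For a free group $G$ with a splitting $\mathcal G:G=G_1*\dots*G_p*F_n$, $\mathcal O(G)$ is the set of minimal simplicial metric $G$-trees (up to equivariant isometry) with trivial edge stabilizers, such that for each $i$ there is exactly one orbit of vertices with stabilizer conjugate to $G_i$, all other vertices have trivial stabilizer, and no vertex with trivial stabilizer is two-valent. For $\Gamma=\sqcup_{i=1}^k\Gamma_i$ put $H_i=\pi_1(\Gamma_i)$ with the splitting given by the vertex-groups, and $\mathcal O(\Gamma)=\prod_i\mathcal O(H_i)$. The open simplex $\Delta_X$ of $X\in\mathcal O(\Gamma)$ is the set of elements of $\mathcal O(\Gamma)$ equivariantly homeomorphic to $X$ (component by component); it is parametrized by assigning an arbitrary positive length to each orbit of edges, and segments are linear in these edge-lengths. **Displacement.** $\mathrm{Aut}(\Gamma)$ consists of tuples $\phi=(\sigma,\phi_1,\dots,\phi_k)$ with $\sigma$ a permutation and $\phi_i:H_i\to H_{\sigma(i)}$ an isomorphism mapping each factor group of the splitting to a conjugate of a factor group; $\phi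 X=(\phi_1X_{\sigma(1)},\dots,\phi_kX_{\sigma(k)})$, where $\phi_iX_{\sigma(i)}$ is $X_{\sigma(i)}$ with $H_i$ acting through $\phi_i$. $\Lambda(X,Y)$ is the minimal Lipschitz constant of tuples of Lipschitz $H_i$-equivariant maps $X_i\to Y_i$, and $\lambda_\phi(X)=\Lambda(X,\phi X)$. **Quasi-convexity.** A function $f:[a_0,b_0]\to\mathbb R$ is quasi-convex if for all $[a,b]\subseteq[a_0,b_0]$ and all $t\in[a,b]$, $f(t)\le\max\{f(a),f(b)\}$. *)

(* Defs.v *)
From HB Require Import structures.
From mathcomp Require Import all_boot all_order all_algebra.
From mathcomp Require Import perm.
From mathcomp Require Import all_classical all_reals all_analysis.
Import Order.TTheory GRing.Theory Num.Theory.
Import numFieldNormedType.Exports.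

Set Implicit Arguments.
Unset Strict Implicit.
Unset Printing Implicit Defensive.

Local Open Scope classical_set_scope.
Local Open Scope ring_scope.

(* Every edge carries a chosen orientation; it is auxiliary, and a dart (e, b) *)
(* is the edge e traversed along (b = true) or against it (b = false).         *)
Record graph := Graph {
  vertex : Type;
  edge : Type;
  src : edge -> vertex;
  tgt : edge -> vertex }.

Section Graphs.
Variable X : graph.

Definition dart : Type := (edge X * bool)%type.
Definition dart_rev (d : dart) : dart := (d.1, ~~ d.2).
Definition dart_src (d : dart) : vertex X := if d.2 then src d.1 else tgt d.1.
Definition dart_tgt (d : dart) : vertex X := dart_src (dart_rev d).

Fixpoint is_path (u : vertex X) (p : seq dart) (v : vertex X) : Prop :=
  if p is d :: q then dart_src d = u /\ is_path (dart_tgt d) q v else u = v.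

Fixpoint reduced (p : seq dart) : Prop :=
  if p is d :: q then
    (if q is d' :: _ then d' <> dart_rev d else True) /\ reduced q
  else True.

Definition connected_graph : Prop :=
  inhabited (vertex X) /\ forall u v, exists p, is_path u p v.

Definition is_tree : Prop :=
  connected_graph /\ forall u p, is_path u p u -> reduced p -> p = [::].

Fixpoint uses_only (F : set (edge X)) (p : seq dart) : Prop :=
  if p is d :: q then F d.1 /\ uses_only F q else True.

(* A nonempty connected subgraph, given by its vertices W and its edges F.    *)
Definition connected_subgraph (W : set (vertex X)) (F : set (edge X)) : Prop :=
  [/\ W !=set0,
      forall e, F e -> W (src e) /\ W (tgt e) &
      forall u v, W u -> W v ->
        exists p, is_path u p v /\ uses_only F p].

Definition star (v : vertex X) : set dart := [set d | dart_src d = v].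

End Graphs.

(* A finite connected graph of groups with trivial edge groups: the edge       *)
(* groups and their inclusions then carry no information.                      *)
Record graph_of_groups := GraphOfGroups {
  ggraph :> graph;
  vertex_group : vertex ggraph -> groupType;
  base : vertex ggraph;
  ggraph_fin_vertex : finite_set [set: vertex ggraph];
  ggraph_fin_edge : finite_set [set: edge ggraph];
  ggraph_connected : connected_graph ggraph }.
Arguments vertex_group {g} _.
Arguments base g : clear implicits.

Section FundamentalGroup.
Variable Y : graph_of_groups.

Inductive gpath : vertex Y -> vertex Y -> Type :=
| gnil v : gpath v v
| gelt v w (g : vertex_group v) (p : gpath v w) : gpath v w
| gfwd e w (p : gpath (tgt e) w) : gpath (src e) w
| gbwd e w (p : gpath (src e) w) : gpath (tgt e) w.

Fixpoint gcat u v w (p : gpath u v) : gpath v w -> gpath u w :=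
  match p in gpath u v return gpath v w -> gpath u w with
  | gnil _ => fun q => q
  | gelt _ _ g p => fun q => gelt g (gcat p q)
  | gfwd _ _ p => fun q => gfwd (gcat p q)
  | gbwd _ _ p => fun q => gbwd (gcat p q)
  end.

Fixpoint ginv u v (p : gpath u v) : gpath v u :=
  match p in gpath u v return gpath v u with
  | gnil v => gnil v
  | gelt v _ g p => gcat (ginv p) (gelt g^-1%g (gnil v))
  | gfwd e _ p => gcat (ginv p) (gbwd (gnil (src e)))
  | gbwd e _ p => gcat (ginv p) (gfwd (gnil (tgt e)))
  end.

Inductive homotopic : forall u v, gpath u v -> gpath u v -> Prop :=
| ht_refl u v (p : gpath u v) : homotopic p p
| ht_sym u v (p q : gpath u v) : homotopic p q -> homotopic q p
| ht_trans u v (p q r : gpath u v) :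
    homotopic p q -> homotopic q r -> homotopic p r
| ht_cat u v w (p p' : gpath u v) (q q' : gpath v w) :
    homotopic p p' -> homotopic q q' -> homotopic (gcat p q) (gcat p' q')
| ht_mul v w (g h : vertex_group v) (p : gpath v w) :
    homotopic (gelt g (gelt h p)) (gelt (g * h)%g p)
| ht_one v w (p : gpath v w) : homotopic (gelt 1%g p) p
| ht_fwd e w (p : gpath (src e) w) : homotopic (gfwd (gbwd p)) p
| ht_bwd e w (p : gpath (tgt e) w) : homotopic (gbwd (gfwd p)) p.

Lemma gcatA u v w x (p : gpath u v) (q : gpath v w) (r : gpath w x) :
  gcat p (gcat q r) = gcat (gcat p q) r.
Proof. by elim: p q => //= *; congr (_ _); auto. Qed.

Lemma gcatp1 u v (p : gpath u v) : gcat p (gnil v) = p.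
Proof. by elim: p => //= *; congr (_ _). Qed.

Lemma gcatpV u v (p : gpath u v) : homotopic (gcat p (ginv p)) (gnil u).
Proof.
elim: p => [w|w x g p IH|e w p IH|e w p IH] /=; first exact: ht_refl.
- rewrite gcatA.
  apply: ht_trans (ht_cat (p := gelt g (gnil w)) (ht_refl _)
                          (ht_cat IH (ht_refl _))) _ => /=.
  by apply: ht_trans (ht_mul _ _ _) _; rewrite mulgV; apply: ht_one.
- rewrite gcatA.
  apply: ht_trans (ht_cat (p := gfwd (gnil (tgt e))) (ht_refl _)
                          (ht_cat IH (ht_refl _))) _ => /=.
  exact: ht_fwd.
- rewrite gcatA.
  apply: ht_trans (ht_cat (p := gbwd (gnil (src e))) (ht_refl _)
                          (ht_cat IH (ht_refl _))) _ => /=.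
  exact: ht_bwd.
Qed.

Lemma gcatVp u v (p : gpath u v) : homotopic (gcat (ginv p) p) (gnil v).
Proof.
elim: p => [w|w x g p IH|e w p IH|e w p IH] /=; first exact: ht_refl.
- rewrite -gcatA /=; apply: ht_trans IH; apply: ht_cat; first exact: ht_refl.
  by apply: ht_trans (ht_mul _ _ _) _; rewrite mulVg; apply: ht_one.
- rewrite -gcatA /=; apply: ht_trans IH; apply: ht_cat; first exact: ht_refl.
  exact: ht_bwd.
- rewrite -gcatA /=; apply: ht_trans IH; apply: ht_cat; first exact: ht_refl.
  exact: ht_fwd.
Qed.

Lemma ginv_homotopic u v (p q : gpath u v) :
  homotopic p q -> homotopic (ginv p) (ginv q).
Proof.
move=> pq; rewrite -(gcatp1 (ginv p)).
apply: ht_trans (ht_cat (ht_refl _) (ht_sym (gcatpV q))) _; rewrite gcatA.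
apply: (ht_trans (q := gcat (gnil v) (ginv q))); last exact: ht_refl.
apply: ht_cat (ht_refl _).
exact: ht_trans (ht_cat (ht_refl _) (ht_sym pq)) (gcatVp p).
Qed.

Definition loop : Type := {classic gpath (base Y) (base Y)}.
HB.instance Definition _ := Choice.on loop.

Definition loop_eqv : rel loop := fun p q => `[< homotopic p q >].

Lemma loop_eqv_refl : reflexive loop_eqv.
Proof. by move=> p; apply/asboolP; apply: ht_refl. Qed.
Lemma loop_eqv_sym : symmetric loop_eqv.
Proof. by move=> p q; apply/asboolP/asboolP; apply: ht_sym. Qed.
Lemma loop_eqv_trans : transitive loop_eqv.
Proof.
move=> q p r /asboolP pq /asboolP qr; apply/asboolP; exact: ht_trans pq qr.
Qed.

Canonical loop_equiv := EquivRel loop_eqv loop_eqv_refl loop_eqv_sym loop_eqv_trans.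

Definition pi1 : Type := {eq_quot loop_eqv}%qT.
HB.instance Definition _ := EqQuotient.on pi1.
HB.instance Definition _ := Choice.on pi1.

Definition class_of (p : gpath (base Y) (base Y)) : pi1 :=
  (\pi_(pi1) (p : loop))%qT.

Lemma class_ofP p q : class_of p = class_of q <-> homotopic p q.
Proof.
rewrite /class_of; split=> [/eqmodP/asboolP //|pq].
by apply/eqmodP/asboolP.
Qed.

Definition pi1_repr (x : pi1) : gpath (base Y) (base Y) := (repr x : loop)%qT.

Lemma pi1_reprK x : class_of (pi1_repr x) = x.
Proof. exact: reprK. Qed.

Lemma pi1_repr_class p : homotopic (pi1_repr (class_of p)) p.
Proof. by apply/class_ofP; rewrite pi1_reprK. Qed.

Definition pi1_one : pi1 := class_of (gnil (base Y)).
Definition pi1_mul (x y : pi1) : pi1 := class_of (gcat (pi1_repr x) (pi1_repr y)).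
Definition pi1_inv (x : pi1) : pi1 := class_of (ginv (pi1_repr x)).

Lemma pi1_mulE p q : pi1_mul (class_of p) (class_of q) = class_of (gcat p q).
Proof. by apply/class_ofP/ht_cat; apply: pi1_repr_class. Qed.

Lemma pi1_invE p : pi1_inv (class_of p) = class_of (ginv p).
Proof. exact/class_ofP/ginv_homotopic/pi1_repr_class. Qed.

Lemma pi1_mulA : associative pi1_mul.
Proof.
by move=> x y z; rewrite -(pi1_reprK x) -(pi1_reprK y) -(pi1_reprK z)
  !pi1_mulE gcatA.
Qed.
Lemma pi1_mul1 : left_id pi1_one pi1_mul.
Proof. by move=> x; rewrite -(pi1_reprK x) pi1_mulE. Qed.
Lemma pi1_mulr1 : right_id pi1_one pi1_mul.
Proof. by move=> x; rewrite -(pi1_reprK x) pi1_mulE gcatp1. Qed.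
Lemma pi1_mulV : left_inverse pi1_one pi1_inv pi1_mul.
Proof.
by move=> x; rewrite -(pi1_reprK x) pi1_invE pi1_mulE; apply/class_ofP/gcatVp.
Qed.
Lemma pi1_mulrV : right_inverse pi1_one pi1_inv pi1_mul.
Proof.
by move=> x; rewrite -(pi1_reprK x) pi1_invE pi1_mulE; apply/class_ofP/gcatpV.
Qed.

HB.instance Definition _ :=
  isGroup.Build pi1 pi1_mulA pi1_mul1 pi1_mulr1 pi1_mulV pi1_mulrV.

(* The image of the vertex group at v in pi1, transported along p. As p runs  *)
(* over all paths from the base vertex to v, these are exactly the conjugates *)
(* of one of them.                                                            *)
Definition vertex_subgroup v (p : gpath (base Y) v) : set pi1 :=
  range (fun g : vertex_group v => class_of (gcat p (gelt g (ginv p)))).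

(* The factors G_1, ..., G_p of the splitting are the nontrivial vertex       *)
(* groups; the rank of the free part F_n is the first Betti number of Y.      *)
Definition factor : Type := {v : vertex Y | exists g : vertex_group v, g != 1%g}.

Definition conj_factor (j : factor) : set (set pi1) :=
  range (fun p : gpath (base Y) (sval j) => vertex_subgroup p).

End FundamentalGroup.

Arguments conj_factor {Y} j.

Section FreeGroup.
Variable G : groupType.

(* The letter (b, true) stands for b, and (b, false) for its inverse.         *)
Definition word_eval (w : seq (G * bool)) : G :=
  foldr (fun x h => (if x.2 then x.1 else x.1^-1) * h)%g 1%g w.

Definition reduced_word (w : seq (G * bool)) : bool :=
  sorted (fun x y => ~~ ((x.1 == y.1) && (x.2 != y.2))) w.

Definition free_basis (B : set G) : Prop :=
  (forall h, exists w, (forall x, x \in w -> B x.1) /\ word_eval w = h) /\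
  (forall w, (forall x, x \in w -> B x.1) -> reduced_word w ->
     word_eval w = 1%g -> w = [::]).

Definition free_group : Prop := exists B, free_basis B.

Definition nontrivial_group : Prop := exists h : G, h != 1%g.

End FreeGroup.

(* A simplicial G-tree, with G acting without inversions: the action preserves *)
(* the chosen orientation. When edge stabilizers are trivial (also setwise),   *)
(* an invariant orientation exists, and nothing below depends on its choice.   *)
Record gtree (G : groupType) := GTree {
  tgraph :> graph;
  tgraph_tree : is_tree tgraph;
  vact : G -> vertex tgraph -> vertex tgraph;
  eact : G -> edge tgraph -> edge tgraph;
  vact1 : forall v, vact 1%g v = v;
  vactM : forall g h v, vact (g * h)%g v = vact g (vact h v);
  eact1 : forall e, eact 1%g e = e;
  eactM : forall g h e, eact (g * h)%g e = eact g (eact h e);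
  vact_src : forall g e, src (eact g e) = vact g (src e);
  vact_tgt : forall g e, tgt (eact g e) = vact g (tgt e) }.

Section GTrees.
Variables (G : groupType) (T : gtree G).

Definition vstab (v : vertex T) : set G := [set g | vact g v = v].
Definition estab (e : edge T) : set G := [set g | eact g e = e].

Definition minimal_tree : Prop :=
  forall (W : set (vertex T)) (F : set (edge T)),
    connected_subgraph W F ->
    (forall g v, W v -> W (vact g v)) ->
    (forall g e, F e -> F (eact g e)) ->
    W = setT /\ F = setT.

End GTrees.

(* The combinatorial part of membership in O(pi1 Y).                           *)
Record outer_space_tree (Y : graph_of_groups) (T : gtree (pi1 Y)) : Prop := {
  ost_minimal : minimal_tree T;
  ost_edge : forall e : edge T, estab e = [set 1%g];
  ost_factor : forall j : factor Y,
    (exists v : vertex T, conj_factor j (vstab v)) /\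
    (forall v w : vertex T, conj_factor j (vstab v) -> conj_factor j (vstab w) ->
       exists g, vact g v = w);
  ost_other : forall v : vertex T,
    (exists j, conj_factor j (vstab v)) \/ vstab v = [set 1%g];
  ost_valence : forall v : vertex T,
    vstab v = [set 1%g] -> ~ (star v #= `I_2)%card }.

Section MetricTrees.
Variable R : realType.

Record lengths (G : groupType) (T : gtree G) := Lengths {
  len_of :> edge T -> R;
  len_gt0 : forall e, 0 < len_of e;
  len_act : forall g e, len_of (eact g e) = len_of e }.

Record metric_tree (G : groupType) := MetricTree {
  mtree :> gtree G;
  mlen : lengths mtree }.

Section Realization.
Variables (G : groupType) (T : gtree G).

(* Points of the geometric realization in barycentric coordinates; faithful    *)
(* because a tree has neither loops nor multiple edges.                        *)
Definition vertex_pt (v : vertex T) : vertex T -> R := \1_[set v].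
Definition edge_pt (e : edge T) (s : R) : vertex T -> R :=
  fun v => (1 - s) * \1_[set src e] v + s * \1_[set tgt e] v.

Definition realization : set (vertex T -> R) :=
  [set x | (exists v, x = vertex_pt v) \/
           (exists e s, 0 <= s <= 1 /\ x = edge_pt e s)].

Definition pact (g : G) (x : vertex T -> R) : vertex T -> R :=
  fun v => x (vact g^-1%g v).

End Realization.
Arguments realization {G} T.

Section Distance.
Variables (G : groupType) (T : metric_tree G).

(* [chain x y L]: a piecewise linear path of length L from x to y.             *)
Inductive chain : (vertex T -> R) -> (vertex T -> R) -> R -> Prop :=
| chain_nil x : chain x x 0
| chain_cons e s s' y L : 0 <= s <= 1 -> 0 <= s' <= 1 ->
    chain (edge_pt e s') y L ->
    chain (edge_pt e s) y (`|s - s'| * mlen T e + L).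

Definition tdist (x y : vertex T -> R) : R := inf [set L | chain x y L].

End Distance.
Arguments tdist {G} T x y.

Section Maps.
Variables (G : groupType) (T T' : metric_tree G).
Implicit Type f : (vertex T -> R) -> (vertex T' -> R).

Definition equivariant f : Prop :=
  forall x, realization T x ->
    realization T' (f x) /\ forall g, f (pact g x) = pact g (f x).

Definition lipschitz_map (K : R) f : Prop :=
  forall x y, realization T x -> realization T y ->
    tdist T' (f x) (f y) <= K * tdist T x y.

Definition continuous_map f : Prop :=
  forall x, realization T x -> forall eps : R, 0 < eps ->
    exists2 delta : R, 0 < delta & forall y, realization T y ->
      tdist T x y < delta -> tdist T' (f x) (f y) < eps.

Definition equivariantly_isometric : Prop :=
  exists f, [/\ equivariant f, f @` realization T = realization T' &
    forall x y, realization T x -> realization T y ->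
      tdist T' (f x) (f y) = tdist T x y].

End Maps.

Definition equivariantly_homeomorphic (G : groupType) (T T' : metric_tree G) :
    Prop :=
  exists (f : (vertex T -> R) -> (vertex T' -> R))
         (f' : (vertex T' -> R) -> (vertex T -> R)),
    [/\ equivariant f /\ equivariant f',
        continuous_map f /\ continuous_map f',
        forall x, realization T x -> f' (f x) = x &
        forall x, realization T' x -> f (f' x) = x].

(* The tree T with G acting through phi : G -> G'.                            *)
Section Twist.
Variables (G G' : groupType) (phi : G -> G').
Hypothesis phiM : {morph phi : x y / (x * y)%g}.
Variable T : metric_tree G'.

Lemma twist_phi1 : phi 1%g = 1%g.
Proof. by apply: (mulgI (phi 1%g)); rewrite -phiM !mulg1. Qed.

Definition twist_gtree : gtree G.
Proof.
refine (@GTree G T (tgraph_tree T) (fun g v => vact (phi g) v)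
                   (fun g e => eact (phi g) e) _ _ _ _ _ _).
- by move=> v; rewrite twist_phi1 vact1.
- by move=> g h v; rewrite phiM vactM.
- by move=> e; rewrite twist_phi1 eact1.
- by move=> g h e; rewrite phiM eactM.
- by move=> g e; rewrite vact_src.
- by move=> g e; rewrite vact_tgt.
Defined.

Definition twist : metric_tree G :=
  @MetricTree G twist_gtree
    (@Lengths G twist_gtree (mlen T) (len_gt0 (mlen T))
       (fun g e => len_act (mlen T) (phi g) e)).

End Twist.

Section OuterSpace.
Variables (k : nat) (Gam : 'I_k -> graph_of_groups).

(* Points of O(Gamma) are represented by tuples of metric trees; passing to    *)
(* equivariant isometry classes is left implicit.                              *)
Definition tree_tuple : Type := forall i : 'I_k, metric_tree (pi1 (Gam i)).

Definition outer_space : set tree_tuple :=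
  [set X | forall i, outer_space_tree (X i)].

Definition open_simplex (X : tree_tuple) : set tree_tuple :=
  [set Z | outer_space Z /\ forall i, equivariantly_homeomorphic (X i) (Z i)].

Definition edge_lengths (X : tree_tuple) : Type := forall i, lengths (X i).

Definition has_edge_lengths (X : tree_tuple) (l : edge_lengths X)
    (Z : tree_tuple) : Prop :=
  forall i, equivariantly_isometric (MetricTree (l i)) (Z i).

(* z parametrizes by [0, 1] the segment of the open simplex of X from A to B.  *)
Definition simplex_segment (X A B : tree_tuple) (z : R -> tree_tuple) : Prop :=
  exists a b : edge_lengths X,
    [/\ has_edge_lengths a A, has_edge_lengths b B &
        forall t, 0 <= t <= 1 -> exists c : edge_lengths X,
          (forall i e, c i e = (1 - t) * a i e + t * b i e) /\
          has_edge_lengths c (z t)].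

(* The constants K admitted by tuples of equivariant K-Lipschitz maps form an   *)
(* up-closed set, whose minimum is written here as an infimum.                 *)
Definition Lambda (X Z : tree_tuple) : R :=
  inf [set K | 0 <= K /\
    exists f : forall i, (vertex (X i) -> R) -> (vertex (Z i) -> R),
      forall i, equivariant (f i) /\ lipschitz_map K (f i)].

Record gog_aut := GogAut {
  aut_perm : {perm 'I_k};
  aut_map : forall i, pi1 (Gam i) -> pi1 (Gam (aut_perm i));
  aut_mapM : forall i, {morph @aut_map i : x y / (x * y)%g};
  aut_map_bij : forall i, bijective (@aut_map i);
  aut_map_factor : forall i (j : factor (Gam i)) A, conj_factor j A ->
    exists j' : factor (Gam (aut_perm i)), conj_factor j' (@aut_map i @` A) }.

Definition aut_act (phi : gog_aut) (X : tree_tuple) : tree_tuple :=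
  fun i => twist (@aut_mapM phi i) (X (aut_perm phi i)).

Definition displacement (phi : gog_aut) (X : tree_tuple) : R :=
  Lambda X (aut_act phi X).

End OuterSpace.

Definition quasi_convex (a0 b0 : R) (f : R -> R) : Prop :=
  forall a b, a0 <= a -> a <= b -> b <= b0 ->
    forall t, a <= t <= b -> f t <= Num.max (f a) (f b).

End MetricTrees.

(* Main.v *)
(* The map phi has a Lipschitz constant at most K, in the sense of Lambda, iff
   N_g <= K D_g for all g, where D_g and N_g are the translation lengths of g in
   X and in phi X.  On a simplex both are linear in the edge lengths, because
   each is the length of a fixed edge path joining v to g v for a vertex v on
   the axis of g (or fixed by g).  So the bounds K at the ends of a segment
   carry over to its points, which is quasi-convexity.  If moreover
   lambda(A) > lambda(B), then N_g - lambda(A) D_g is nonpositive at A and at most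
   (lambda(B) - lambda(A)) D_g at B; since the lengths D_g at different points of
   the segment are comparable uniformly in g, lambda < lambda(A) at every point
   of the segment other than A.

   To build a K-Lipschitz map from the inequalities N_g <= K D_g, images of the
   vertices are chosen one orbit at a time: they are subject to finitely many
   constraints d(y, p) <= r and d(y, g y) <= c, which define convex subsets of a
   real tree that meet pairwise, hence all together by the Helly property. *)

Require Import Defs.
From mathcomp Require Import all_boot all_order all_algebra.
From mathcomp Require Import perm.
From mathcomp Require Import all_classical all_reals all_analysis.
From mathcomp Require Import ring lra zify.
From Stdlib Require List.
Import Order.TTheory GRing.Theory Num.Theory.
Import numFieldNormedType.Exports.

Set Implicit Arguments.
Unset Strict Implicit.
Unset Printing Implicit Defensive.

Local Open Scope classical_set_scope.
Local Open Scope ring_scope.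

(** * Real trees *)

(** The delicate pair for the Helly property consists of two displacement bounds, [d y (g y) <= c]
    and [d y (h y) <= c']. If both sets are nonempty but disjoint, a ping-pong argument shows that
    [g h] displaces every point by more than [c + c']. The inequality for the product [g h] excludes
    this, which is why the criterion runs over all group elements. Orbits are eliminated in the
    manner of Fourier and Motzkin: the conditions that make the sets for the last orbit meet
    pairwise are again distance constraints between vertices of the other orbits. The induction
    therefore runs over arbitrary finite systems of pairs of vertices, not only over edges. It
    starts from the vertices with nontrivial stabilizer, whose images are forced, since a nontrivial
    element fixes at most one point of the target. Writing N_g <= K D_g instead of a quotient covers
    the elliptic g, where D_g = 0. That there are finitely many constraints rests on minimality of
    the trees, which bounds the number of edge orbits. *)

Record tree_metric (R : realType) (M : Type) (d : M -> M -> R) : Prop := {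
  tm_refl : forall x, d x x = 0;
  tm_sym : forall x y, d x y = d y x;
  tm_eq0 : forall x y, d x y = 0 -> x = y;
  tm_geodesic : forall x y r, 0 <= r <= d x y ->
    exists z, d x z = r /\ d z y = d x y - r;
  tm_four : forall x y z w,
    d x y + d z w <= d x z + d y w \/ d x y + d z w <= d x w + d y z }.

Section RealTree.
Variables (R : realType) (M : Type) (d : M -> M -> R).
Hypothesis tm : tree_metric d.

Let dxx := tm_refl tm.
Let dC := tm_sym tm.
Let four := tm_four tm.

(** This is the four-point condition with a repeated point, so it is no separate axiom. *)
Lemma tm_tri x y z : d x z <= d x y + d y z.
Proof. by case: (four x z y y); rewrite dxx (dC z y); lra. Qed.

Lemma tm_ge0 x y : 0 <= d x y.
Proof. by have := tm_tri x y x; rewrite dxx (dC y x); lra. Qed.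

Definition between x m y := d x y = d x m + d m y.

(** With the triangle inequality either alternative is an equality: seen from [p], the point [m] of
    the segment lies on the way to [x] or on the way to [y]. *)
Lemma between_le x m y p : between x m y ->
  d m p <= d x p - d x m \/ d m p <= d y p - d m y.
Proof.
rewrite /between => xmy.
have := dC m x; have := dC p y; have := dC p x; case: (four m p x y); lra.
Qed.

Lemma median x y z : exists m,
  [/\ between x m y, between y m z & between x m z].
Proof.
have := tm_tri x y z; have := tm_tri x z y; have := tm_tri y x z.
rewrite (dC y x) (dC z y) => t1 t2 t3.
(* The distance from [x] to the branch point is the Gromov product of [y] and [z] at [x]. *)
have [|m [xm my]] := @tm_geodesic _ _ _ tm x y ((d x y + d x z - d y z) / 2).
  by apply/andP; split; lra.
have xmy : between x m y by rewrite /between; lra.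
have := tm_tri x m z; have := tm_tri y m z; rewrite (dC y m) => t4 t5.
exists m; rewrite /between (dC y m); split; first lra.
- by case: (between_le z xmy); lra.
- by case: (between_le z xmy); lra.
Qed.

Definition geodesically_convex (C : M -> Prop) :=
  forall a b m, C a -> C b -> between a m b -> C m.

(** The median of one point from each pairwise intersection lies in all three sets. *)
Lemma helly3 (A B C : M -> Prop) :
  geodesically_convex A -> geodesically_convex B -> geodesically_convex C ->
  (exists x, A x /\ B x) -> (exists x, B x /\ C x) -> (exists x, A x /\ C x) ->
  exists x, [/\ A x, B x & C x].
Proof.
move=> cA cB cC [x [Ax Bx]] [y [By Cy]] [z [Az Cz]].
have [m [xmy ymz xmz]] := median x y z.
by exists m; split; [exact: cA xmz|exact: cB xmy|exact: cC ymz].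
Qed.

Lemma helly (I : Type) (C : I -> M -> Prop) (l : seq I) (D : M -> Prop) :
  (forall i, geodesically_convex (C i)) -> geodesically_convex D -> (exists x, D x) ->
  (forall i, List.In i l -> exists x, D x /\ C i x) ->
  (forall i j, List.In i l -> List.In j l -> exists x, C i x /\ C j x) ->
  exists x, D x /\ forall i, List.In i l -> C i x.
Proof.
move=> cC; elim: l D => [|i l IH] D cD neD DC CC.
  by have [x Dx] := neD; exists x.
have [|||i1 i2 il1 il2|x [[Dx Cx] Cl]] := IH (fun x => D x /\ C i x).
- by move=> a b m [Da Ca] [Db Cb] amb; split; [exact: cD amb|exact: cC amb].
- by apply: DC; left.
- move=> j jl.
  have [|||x [Dx Cix Cjx]] := @helly3 D (C i) (C j) cD (cC i) (cC j).
  + by apply: DC; left.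
  + by apply: CC; [left|right].
  + by apply: DC; right.
  + by exists x.
- by apply: CC; right.
by exists x; split=> // j [<-//|]; apply: Cl.
Qed.

Lemma ball_convex p r : geodesically_convex (fun y => d p y <= r).
Proof.
move=> a b m pa pb amb; have := tm_ge0 a m; have := tm_ge0 m b.
by case: (between_le p amb); rewrite !(dC _ p); lra.
Qed.

(** * Displacement of one isometry *)

Section Isometry.
Variable g : M -> M.
Hypothesis gd : forall x y, d (g x) (g y) = d x y.

Lemma displacement_convex c : geodesically_convex (fun y => d y (g y) <= c).
Proof.
move=> a b m /= ac bc amb.
have amb' : between (g a) (g m) (g b) by rewrite /between !gd.
have := tm_tri b (g b) (g a); have := tm_tri a (g a) (g b).
have := tm_ge0 a m; have := tm_ge0 m b.
have := dC b a; have := dC (g m) a; have := dC (g m) b.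
have := dC (g a) a; have := dC (g a) b; have := dC (g b) a; have := dC (g b) b.
have := between_le (g m) amb; have := between_le a amb'.
have := between_le b amb'.
by move: amb; rewrite /between !gd => ? [?|?] [?|?] [?|?] *; lra.
Qed.

Lemma iter_isometry n x y : d (iter n g x) (iter n g y) = d x y.
Proof. by elim: n => //= n IH; rewrite gd. Qed.

Lemma iter_displacement_le n x : d x (iter n g x) <= n%:R * d x (g x).
Proof.
elim: n => [|n IH] /=; first by rewrite dxx mul0r.
have := tm_tri x (iter n g x) (iter n.+1 g x).
by rewrite [in d (iter n g x) _]iterSr iter_isometry -natr1 /=; lra.
Qed.

(** The excess [e] of the second displacement over the first is gained again at each further
    iterate, by the four-point condition; the induction carries this gain along with the bound. *)
Lemma iter_displacement_ge n x :
  d x (g x) < d x (g (g x)) ->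
  d x (g x) + n%:R * (d x (g (g x)) - d x (g x)) <= d x (iter n.+1 g x).
Proof.
set e := _ - _ => lt12.
suff: d x (iter n.+1 g x) + e <= d x (iter n.+2 g x) /\
      d x (g x) + n%:R * e <= d x (iter n.+1 g x) by case.
elim: n => [|n [IH1 IH2]]; first by rewrite /= /e; split; lra.
set y := iter n.+1 g x in IH1 IH2 *.
have e1 : d y (g y) = d x (g x) by rewrite -(iter_isometry n.+1 x (g x)) -iterSr.
have := four x (g y) (g x) (g (g y)).
have := ler0n R n; have : 0 < e by rewrite /e; lra.
change (is_true (d x y + e <= d x (g y))) in IH1.
change (iter n.+3 g x) with (g (g y)); change (iter n.+2 g x) with (g y).
clearbody y; rewrite !gd -natr1 e1 (dC y x).
by move=> e0 n0 [?|?]; split; nra.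
Qed.

(** The orbit of [x] recedes at rate at least [d x (g (g x)) - d x (g x)], that of [y] at rate at
    most [d y (g y)], and the two orbits stay at constant distance. So the left rate cannot exceed
    the right one. *)
Lemma displacement_twice x y : d x (g (g x)) <= d x (g x) + d y (g y).
Proof.
rewrite leNgt; apply/negP => lt.
have y0 := tm_ge0 y (g y); have xy0 := tm_ge0 x y.
have lt12 : d x (g x) < d x (g (g x)) by lra.
set c := d x (g (g x)) - d x (g x) - d y (g y).
have c0 : 0 < c by rewrite /c; lra.
(* After [n] iterations the supposed gap [c] between the two rates outweighs the bounded error. *)
pose n := Num.Def.archi_bound ((2 * d x y + d y (g y)) / c).
have : (2 * d x y + d y (g y)) / c < n%:R.
  by apply/archi_boundP/divr_ge0; lra.
rewrite ltr_pdivrMr // => ltn.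
have := iter_displacement_ge n lt12; have := iter_displacement_le n.+1 y.
have := tm_tri x y (iter n.+1 g x).
have := tm_tri y (iter n.+1 g y) (iter n.+1 g x).
rewrite iter_isometry (dC y x) -natr1 => h1 h2 h3 h4.
have := tm_ge0 x (g x); rewrite /c in ltn *; nra.
Qed.

(** Moving from [b] towards [g b] lowers the displacement at twice the speed; the point [y]
    guarantees that the move has not gone beyond the points of least displacement. *)
Lemma displacement_on_segment b q : between b q (g b) ->
  (exists y, d y (g y) <= d b (g b) - 2 * d b q) ->
  d q (g q) = d b (g b) - 2 * d b q.
Proof.
move=> bq [y ley]; have lt2 := displacement_twice b y.
have bq' : between (g b) (g q) (g (g b)) by rewrite /between !gd.
have := between_le (g q) bq; have := between_le b bq'.
have := tm_tri b q (g b); have := tm_tri q (g q) (g b).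
move: bq bq'; rewrite /between !gd => bq bq'.
have := dC (g q) q; have := dC (g q) b; have := dC (g b) b.
have := dC (g q) (g b); have := dC (g (g b)) b; have := tm_ge0 y (g y).
have := gd q b; have := dC q b; have := tm_ge0 b q.
rewrite gd => ? ? ? ? ? ? ? ? ? ? ? [?|?] [?|?]; lra.
Qed.

Lemma displacement_projection b c : 0 <= c -> c <= d b (g b) ->
  (exists y, d y (g y) <= c) ->
  exists q, [/\ d b q = (d b (g b) - c) / 2, between b q (g b) & d q (g q) = c].
Proof.
move=> c0 lec [y ley].
have [|q [bq qb]] := @tm_geodesic _ _ _ tm b (g b) ((d b (g b) - c) / 2).
  by apply/andP; split; lra.
have bqb : between b q (g b) by rewrite /between; lra.
exists q; split=> //; rewrite (displacement_on_segment bqb) ?bq; first lra.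
by exists y; lra.
Qed.

End Isometry.

(** * Two isometries *)

Section TwoIsometries.
Variables g h : M -> M.
Hypothesis gd : forall x y, d (g x) (g y) = d x y.
Hypothesis hd : forall x y, d (h x) (h y) = d x y.

(* The segments from x to g x and g^-1 x leave x away from b, those to h x and
   h^-1 x leave it towards b; hence x lies on the axis of g h. *)
Lemma ping_pong x b :
  0 < d x (g x) -> 0 < d x (h x) ->
  between b x (g x) -> d x (g b) = d b x + d x (g x) ->
  d b (h x) < d b x + d x (h x) -> d x (h b) < d b x + d x (h x) ->
  forall y, d x (g x) + d x (h x) <= d y (g (h y)).
Proof.
rewrite /between => A0 B0 bx1 bx2 bx3 bx4 y.
have ghd u v : d (g (h u)) (g (h v)) = d u v by rewrite gd hd.
have le1 : d x (g x) + d x (h x) <= d x (g (h x)).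
  have := four x (g b) (g x) (g (h x)).
  have := gd x (h x); have := gd b (h x); have := gd b x.
  have := dC (g x) (g b).
  by move=> ? ? ? ? [?|?]; lra.
have le2 : d x (g x) + d x (h x) <= d x (h (g x)).
  have := four (h b) (h (g x)) x (h x).
  have := hd b (g x); have := hd (g x) x; have := hd b x.
  have := dC (g x) x; have := dC x (h b); have := dC x (h (g x)).
  have := dC (h (g x)) (h x); have := dC (h x) x.
  by move=> ? ? ? ? ? ? ? ? [?|?]; lra.
have le3 : 2 * d x (g x) + d x (h x) <= d x (g (h (g x))).
  have := four x (g (h x)) (g x) (g (h (g x))).
  have := gd x (h (g x)); have := ghd x (g x); have := gd x (h x).
  have := dC (g (h x)) (g x).
  by move=> ? ? ? ? [?|?]; lra.
have le4 : 2 * d x (g x) + 2 * d x (h x) <= d x (g (h (g (h x)))).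
  have := four x (g (h (g x))) (g (h x)) (g (h (g (h x)))).
  have := ghd x (g (h x)); have := ghd (g x) (g (h x)); have := gd x (h x).
  have := ghd x (g x); have := tm_tri x (g x) (g (h x)).
  have := dC (g (h (g x))) (g (h x)).
  by move=> ? ? ? ? ? ? [?|?]; lra.
(* The square of [g h] moves [x] by at least twice the sum of the two displacements, [g h] itself by
   at most the sum; the difference bounds every displacement of [g h] from below. *)
have := displacement_twice ghd x y.
by have := tm_tri x (g x) (g (h x)); rewrite gd; lra.
Qed.

(** Project a point [b] of the set for [h] to the set for [g]. If the projection [q] misses the set
    for [h], ping-pong near [q] contradicts the bound on [g h]. *)
Lemma displacement_sets_meet c c' :
  0 <= c -> 0 <= c' ->
  (exists y, d y (g y) <= c) -> (exists y, d y (h y) <= c') ->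
  (exists y, d y (g (h y)) <= c + c') ->
  exists y, d y (g y) <= c /\ d y (h y) <= c'.
Proof.
move=> c0 c'0 neg [b hb] [y ygh].
have [?|ltb] := leP (d b (g b)) c; first by exists b.
have [q [bq bqb gq]] := displacement_projection gd c0 (ltW ltb) neg.
have [?|ltq] := leP (d q (h q)) c'; first by exists q; rewrite gq.
(* The point [x] stops short of [q] by [del]. Its displacement under [g] is then [c + 2 * del],
   positive even if [c] is 0, as [ping_pong] asks; a quarter of the excess keeps its displacement
   under [h] above [c']. *)
pose del := Num.min ((d q (h q) - c') / 4) (d b q).
have del0 : 0 < del by rewrite /del lt_min; apply/andP; split; lra.
have del1 : del <= (d q (h q) - c') / 4 by rewrite /del ge_min lexx.
have del2 : del <= d b q by rewrite /del ge_min lexx orbT.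
have [|x [bx xq]] := @tm_geodesic _ _ _ tm b q (d b q - del).
  by apply/andP; split; lra.
have xqg := tm_tri x q (g b); have bxg := tm_tri b x (g b).
have bxb : between b x (g b) by move: bqb; rewrite /between; lra.
have [y0 gy0] := neg.
have gx : d x (g x) = d b (g b) - 2 * d b x.
  by apply: displacement_on_segment => //; exists y0; lra.
have hx : c' < d x (h x).
  have := tm_tri q x (h q); have := tm_tri x (h x) (h q).
  by rewrite hd (dC q x); lra.
have bx2 : d x (g b) = d b x + d x (g x) by move: bxb; rewrite /between; lra.
suff: forall y, d x (g x) + d x (h x) <= d y (g (h y)).
  by move=> /(_ y); lra.
apply: (@ping_pong x b) => //.
- by lra.
- by lra.
- rewrite /between.
  have := tm_tri b x (g x); have := four b (g x) x (g b).
  have := gd x b; have := dC (g b) x; have := dC x b.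
  have := dC (g x) x.
  have := tm_tri b (g x) (g b).
  by move: bxb; rewrite /between => ? ? ? ? ? ? [?|?]; lra.
- have := tm_tri b (h b) (h x); rewrite hd; lra.
- have := tm_tri x b (h b); have := dC x b; lra.
Qed.

End TwoIsometries.

Lemma ball_displacement_meet g p r c :
  (forall x y, d (g x) (g y) = d x y) ->
  0 <= r -> 0 <= c -> (exists y, d y (g y) <= c) ->
  d p (g p) <= 2 * r + c ->
  exists y, d p y <= r /\ d y (g y) <= c.
Proof.
move=> gd r0 c0 ney lep.
have [?|ltp] := leP (d p (g p)) c; first by exists p; rewrite dxx.
have [q [pq _ gq]] := displacement_projection gd c0 (ltW ltp) ney.
by exists q; rewrite gq; split=> //; lra.
Qed.

Lemma balls_meet p p' r r' :
  0 <= r -> 0 <= r' -> d p p' <= r + r' -> exists y, d p y <= r /\ d p' y <= r'.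
Proof.
move=> r0 r'0 lep; have p0 := tm_ge0 p p'.
have [?|ltp] := leP (d p p') r; first by exists p'; rewrite dxx.
have [|z [pz zp]] := @tm_geodesic _ _ _ tm p p' r; first by apply/andP; split; lra.
by exists z; rewrite (dC p'); split; lra.
Qed.

End RealTree.

(** * Equivariant maps into a real tree under distance constraints *)

Section Extension.
Variables (R : realType) (G : groupType) (V M : Type).
Variables (actV : G -> V -> V) (actM : G -> M -> M).
Variables (L : V -> V -> R) (d : M -> M -> R).
Hypothesis tm : tree_metric d.
Hypothesis actV1 : forall v, actV 1%g v = v.
Hypothesis actVM : forall g h v, actV (g * h)%g v = actV g (actV h v).
Hypothesis actM1 : forall y, actM 1%g y = y.
Hypothesis actMM : forall g h y, actM (g * h)%g y = actM g (actM h y).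
Hypothesis actMd : forall g x y, d (actM g x) (actM g y) = d x y.
Hypothesis L_refl : forall v, L v v = 0.
Hypothesis LC : forall v w, L v w = L w v.
Hypothesis L_tri : forall u v w, L u w <= L u v + L v w.
Hypothesis L_act : forall g v w, L (actV g v) (actV g w) = L v w.
Hypothesis displacement_le : forall g v, exists y, d y (actM g y) <= L v (actV g v).
Hypothesis fixed_unique : forall g y y',
  g != 1%g -> actM g y = y -> actM g y' = y' -> y = y'.
Hypothesis stab_fixes : forall v, exists y, forall g,
  actV g v = v -> actM g y = y.

Let L_ge0 v w : 0 <= L v w.
Proof. by have := L_tri v w v; rewrite L_refl (LC w v); lra. Qed.

Lemma actVK g v : actV g^-1%g (actV g v) = v.
Proof. by rewrite -actVM mulVg actV1. Qed.

Definition free_vertex v := forall g, actV g v = v -> g = 1%g.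

(** The vertices whose images are settled once the orbits in [l] are treated; those with nontrivial
    stabilizer count from the start. *)
Definition covered (l : seq V) v :=
  ~ free_vertex v \/ exists u g, List.In u l /\ v = actV g u.

Lemma free_vertex_act g v : free_vertex v -> free_vertex (actV g v).
Proof.
move=> fv h; rewrite -actVM => e.
suff : (h ^ g)%g = 1%g by move/eqP; rewrite conjg_eq1 => /eqP.
by apply: fv; rewrite conjgE actVM e actVK.
Qed.

Lemma covered_act l g v : covered l v -> covered l (actV g v).
Proof.
case=> [nf|[u [h [ul ->]]]]; [left|right].
  by move=> /(@free_vertex_act g^-1%g _); rewrite actVK.
by exists u, (g * h)%g; rewrite actVM.
Qed.

Lemma covered_actV l g v : covered l (actV g v) -> covered l v.
Proof. by move/(@covered_act _ g^-1%g _); rewrite actVK. Qed.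

(** Take nontrivial [a], [b] fixing [u], [u']. The product [a b] moves [u'] by at most [2 * L u u'],
    so some [x] is moved by at most [L u u'] by each of [a] and [b]. A point is moved by twice its
    distance to the fixed point, hence [x] is within half of [L u u'] of both [y] and [y']. *)
Lemma fixed_points_le u u' y y' :
  ~ free_vertex u -> ~ free_vertex u' ->
  (forall g, actV g u = u -> actM g y = y) ->
  (forall g, actV g u' = u' -> actM g y' = y') ->
  d y y' <= L u u'.
Proof.
have exg v : ~ free_vertex v -> exists g, g != 1%g /\ actV g v = v.
  move=> nf; apply: contrapT => ne; apply: nf => g gv; apply/eqP.
  by apply: contraT => g1; case: ne; exists g.
have half g x z : g != 1%g -> actM g z = z -> d x (actM g x) = 2 * d x z.
  move=> g1 gz.
  have [|q [xq _ /(tm_eq0 tm) qgq]] :=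
    displacement_projection tm (actMd g) (lexx 0) (tm_ge0 tm x (actM g x)).
    by exists z; rewrite gz (tm_refl tm).
  by rewrite (fixed_unique g1 gz (esym qgq)) xq; lra.
move=> /exg[a [a1 au]] /exg[b [b1 bu']] ay by'.
have {}ay := ay _ au; have by'' := by' _ bu'.
have [|||||x []] :=
  @displacement_sets_meet _ _ _ tm _ _ (actMd a) (actMd b) (L u u') (L u u').
- exact: L_ge0.
- exact: L_ge0.
- by exists y; rewrite ay (tm_refl tm).
- by exists y'; rewrite by'' (tm_refl tm).
- have [y0] := displacement_le (a * b)%g u'.
  rewrite actMM actVM bu' => ley0; exists y0; apply: le_trans ley0 _.
  have e : L u (actV a u') = L u u' by rewrite -[in LHS]au L_act.
  by have := L_tri u' u (actV a u'); rewrite e (LC u' u).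
rewrite (half _ _ _ a1 ay) (half _ _ _ b1 by'') => le1 le2.
by have := tm_tri tm y x y'; rewrite (tm_sym tm y x); lra.
Qed.

(* Equivariance turns the constraints involving the orbit of v0 into constraints
   on f v0 alone: balls centred at f u for u in B, and bounds on the displacement
   of f v0 by the g in C. *)
Lemma constraint_split (v0 : V) (l : seq V) (S : seq (V * V)) :
  (forall p, List.In p S -> covered (v0 :: l) p.1 /\ covered (v0 :: l) p.2) ->
  exists (S0 : seq (V * V)) (B : seq V) (C : seq G),
  [/\ forall p, List.In p S0 -> covered l p.1 /\ covered l p.2,
      forall u, List.In u B -> covered l u &
      forall f : V -> M,
        (forall g v, covered (v0 :: l) v -> f (actV g v) = actM g (f v)) ->
        (forall p, List.In p S0 -> d (f p.1) (f p.2) <= L p.1 p.2) ->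
        (forall u, List.In u B -> d (f u) (f v0) <= L u v0) ->
        (forall g, List.In g C -> d (f v0) (actM g (f v0)) <= L v0 (actV g v0)) ->
        forall p, List.In p S -> d (f p.1) (f p.2) <= L p.1 p.2].
Proof.
have cov v : covered (v0 :: l) v -> covered l v \/ exists g, v = actV g v0.
  case=> [nf|[u [g [[<-|ul] ->]]]]; first by left; left.
    by right; exists g.
  by left; right; exists u, g.
have v0c : covered (v0 :: l) v0.
  by right; exists v0, 1%g; rewrite actV1; split=> //; left.
elim: S => [|p S IH] Sl; first by exists [::], [::], [::]; split.
have [|S0 [B [C [hS0 hB hS]]]] := IH; first by move=> q qS; apply: Sl; right.
have [/cov c1 /cov c2] := Sl p (or_introl erefl).
case: p c1 c2 {Sl IH} => v w /= [cv|[g ev]] [cw|[h ew]].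
- exists ((v, w) :: S0), B, C; split=> // [q [<-//|]|f fe fS0 fB fC q [<-|qS]].
  + exact: hS0.
  + by apply: fS0; left.
  + by apply: hS => // r rS0; apply: fS0; right.
- exists S0, (actV h^-1%g v :: B), C; split=> // [u [<-|]|f fe fS0 fB fC q [<-|qS]].
  + exact: covered_act.
  + exact: hB.
  + rewrite /= ew fe // -(L_act h^-1%g) actVK -(actMd h^-1%g) -actMM mulVg actM1.
    rewrite -fe; first by apply: fB; left.
    by case: cv => [nf|[u [k [ul ->]]]]; [left|right; exists u, k; split=> //; right].
  + by apply: hS => // r rS0; apply: fB; right.
- exists S0, (actV g^-1%g w :: B), C; split=> // [u [<-|]|f fe fS0 fB fC q [<-|qS]].
  + exact: covered_act.
  + exact: hB.
  + rewrite /= ev fe // LC (tm_sym tm).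
    rewrite -(L_act g^-1%g) actVK -(actMd g^-1%g) -actMM mulVg actM1.
    rewrite -fe; first by apply: fB; left.
    by case: cw => [nf|[u [k [ul ->]]]]; [left|right; exists u, k; split=> //; right].
  + by apply: hS => // r rS0; apply: fB; right.
- exists S0, B, ((g^-1 * h)%g :: C); split=> // f fe fS0 fB fC q [<-|qS].
  + rewrite /= ev ew !fe // -(L_act g^-1%g) actVK -actVM.
    rewrite -(actMd g^-1%g) -!actMM mulVg actM1.
    by apply: fC; left.
  + by apply: hS => // r rS0; apply: fC; right.
Qed.

(** Induction on the orbits. The list [S] is general because eliminating the orbit of [v0] adds new
    pairs; the image of [v0] is chosen after all the others. *)
Lemma equivariant_extension_covered (l : seq V) (S : seq (V * V)) :
  (forall p, List.In p S -> covered l p.1 /\ covered l p.2) ->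
  exists f : V -> M,
    (forall g v, covered l v -> f (actV g v) = actM g (f v)) /\
    forall p, List.In p S -> d (f p.1) (f p.2) <= L p.1 p.2.
Proof.
elim: l S => [|v0 l IH] S Sl.
  have /choice[f fP] := stab_fixes.
  have nf v : covered [::] v -> ~ free_vertex v by case=> // -[u [g []]].
  exists f; split=> [g v /nf nfv|p /Sl[/nf n1 /nf n2]]; last first.
    exact: fixed_points_le n1 n2 (fP _) (fP _).
  have [a [a1 av]] : exists a, a != 1%g /\ actV a v = v.
    apply: contrapT => ne; apply: nfv => a av; apply/eqP.
    by apply: contraT => a1; case: ne; exists a.
  (* The conjugate of [a] by [g] fixes both [f (actV g v)] and [actM g (f v)], so uniqueness of
     fixed points gives equivariance. *)
  have ga1 : (g * a * g^-1)%g != 1%g.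
    by rewrite -mulgA -{1}(invgK g) -conjgE conjg_eq1.
  apply: (fixed_unique ga1); first by apply: fP; rewrite !actVM actVK av.
  by rewrite -!actMM mulgVK actMM fP.
have [cv0|ncv0] := pselect (covered l v0).
  have sub v : covered (v0 :: l) v -> covered l v.
    case=> [nf|[u [g [[<-|ul] ->]]]]; first by left.
      exact: covered_act.
    by right; exists u, g.
  have [|f [fe fS]] := IH S.
    by move=> p /Sl[c1 c2]; split; apply: sub.
  by exists f; split=> // g v /sub; apply: fe.
have fv0 : free_vertex v0 by apply: contrapT => nf; apply: ncv0; left.
have [S0 [B [C [hS0 hB hS]]]] := constraint_split Sl.
(* The pairs [(u, u')] will make two balls meet, the pairs [(u, g u)] a ball and a displacement set.
   Two displacement sets meet by [displacement_le] for the product, without a further pair. *)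
pose S1 := app S0 (app (List.list_prod B B)
  (List.map (fun p => (p.1, actV p.2 p.1)) (List.list_prod B C))).
have S1P p : List.In p S1 <-> List.In p S0 \/
    (exists u u', [/\ List.In u B, List.In u' B & p = (u, u')]) \/
    (exists u g, [/\ List.In u B, List.In g C & p = (u, actV g u)]).
  rewrite /S1 !List.in_app_iff List.in_map_iff; split.
    case=> [?|[|]]; first by left.
      by case: p => u u' /List.in_prod_iff[? ?]; right; left; exists u, u'.
    by move=> [[u g] /= [<- /List.in_prod_iff[? ?]]]; right; right; exists u, g.
  case=> [?|[[u [u' [? ? ->]]]|[u [g [? ? ->]]]]]; first by left.
    by right; left; apply/List.in_prod_iff.
  by right; right; exists (u, g); split=> //; apply/List.in_prod_iff.
have [|f' [f'e f'S]] := IH S1.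
  move=> p /S1P[/hS0//|[[u [u' [uB u'B ->]]]|[u [g [uB gC ->]]]]].
    by split; apply: hB.
  by split; [|apply: covered_act]; apply: hB.
pose Cs (i : V + G) (y : M) := match i with
  | inl u => d (f' u) y <= L u v0
  | inr g => d y (actM g y) <= L v0 (actV g v0) end.
pose idx : seq (V + G) := app (List.map inl B) (List.map inr C).
have inidx i : List.In i idx <->
  match i with inl u => List.In u B | inr g => List.In g C end.
  rewrite /idx List.in_app_iff !List.in_map_iff; case: i => x; split.
  - by case=> -[x' []] // [<-].
  - by left; exists x.
  - by case=> -[x' []] // [<-].
  - by right; exists x.
have convC i : geodesically_convex d (Cs i).
  by case: i => [u|g]; [apply: ball_convex|apply: displacement_convex].
have meet i j : List.In i idx -> List.In j idx -> exists y, Cs i y /\ Cs j y.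
  have bd u g : List.In u B -> List.In g C ->
    exists y, Cs (inl u) y /\ Cs (inr g) y.
    move=> uB gC; apply: ball_displacement_meet => //.
    rewrite -f'e; last exact: hB.
    apply: (@le_trans _ _ (L u (actV g u))).
      by apply: (f'S (u, actV g u)); apply/S1P; right; right; exists u, g.
    have := L_tri u v0 (actV g u); have := L_tri v0 (actV g v0) (actV g u).
    by rewrite L_act (LC v0 u); lra.
  move=> /inidx; case: i => [u|g] uB /inidx; case: j => [u'|h] u'B.
  - apply: balls_meet => //; apply: le_trans (_ : L u u' <= _).
      by apply: (f'S (u, u')); apply/S1P; right; left; exists u, u'.
    by rewrite (LC u' v0).
  - exact: bd.
  - by have [y []] := bd _ _ u'B uB; exists y.
  - apply: displacement_sets_meet => //.
    have [y] := displacement_le (g * h)%g v0.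
    rewrite actMM actVM => ley; exists y; apply: le_trans ley _.
    by have := L_tri v0 (actV g v0) (actV g (actV h v0)); rewrite L_act.
have [||||y [_ yP]] := @helly _ _ _ tm _ Cs idx (fun _ => True) convC.
- by [].
- by have [y _] := stab_fixes v0; exists y.
- by move=> i il; have [y [Cy _]] := meet _ _ il il; exists y.
- exact: meet.
(* The last [y] is a default for vertices not yet covered. On the orbit of [v0] the value does not
   depend on the chosen group element, because [v0] is free. *)
pose f v : M := if pselect (covered l v) is left _ then f' v else
  if pselect (exists g, v = actV g v0) is left e then actM (sval (cid e)) y else y.
have fl v : covered l v -> f v = f' v by rewrite /f; case: pselect.
have f0 g : f (actV g v0) = actM g y.
  rewrite /f; case: pselect => [/covered_actV//|_].
  case: pselect => [e|]; last by case; exists g.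
  case: (cid e) => h /= eh; congr (actM _ y).
  have /(canRL (mulVKg g)) : (g^-1 * h)%g = 1%g by apply: fv0; rewrite actVM -eh actVK.
  by rewrite mulg1.
have f00 : f v0 = y by rewrite -{1}(actV1 v0) f0 actM1.
have fe g v : covered (v0 :: l) v -> f (actV g v) = actM g (f v).
  move=> [nf|[u [h [[<-|ul] ->]]]].
  - have cv : covered l v by left.
    by rewrite (fl _ (covered_act g cv)) f'e // fl.
  - by rewrite -actVM !f0 actMM.
  - have cu : covered l (actV h u) by right; exists u, h.
    by rewrite (fl _ (covered_act g cu)) f'e // fl.
exists f; split=> //; apply: hS => //.
- move=> p pS0; have [c1 c2] := hS0 _ pS0; rewrite !fl //; apply: f'S.
  by apply/S1P; left.
- move=> u uB; rewrite f00 fl; last exact: hB.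
  by apply: (yP (inl u)); apply/inidx.
- by move=> g gC; rewrite f00; apply: (yP (inr g)); apply/inidx.
Qed.

Lemma equivariant_extension (l : seq V) (S : seq (V * V)) :
  (forall v, exists u g, List.In u l /\ v = actV g u) ->
  exists f : V -> M,
    (forall g v, f (actV g v) = actM g (f v)) /\
    forall p, List.In p S -> d (f p.1) (f p.2) <= L p.1 p.2.
Proof.
move=> lV; have cov v : covered l v by right; apply: lV.
have [//|f [fe fS]] := @equivariant_extension_covered l S.
by exists f; split=> // g v; apply: fe.
Qed.

End Extension.

(** * Paths in simplicial trees *)

Section Paths.
Variable X : graph.
Implicit Types (u v w : vertex X) (d : dart X) (p q : seq (dart X)).

Lemma dart_revK : involutive (@dart_rev X).
Proof. by case=> e b; rewrite /dart_rev /= negbK. Qed.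

Lemma dart_tgt_rev d : dart_tgt (dart_rev d) = dart_src d.
Proof. by rewrite /dart_tgt dart_revK. Qed.

Lemma is_path_cat u w p q :
  is_path u (p ++ q) w <-> exists v, is_path u p v /\ is_path v q w.
Proof.
elim: p u => [|d p IH] u /=.
  by split=> [|[v [-> //]]]; exists u.
split=> [[-> /IH[v [pv vq]]]|[v [[-> pv] vq]]]; first by exists v.
by split=> //; apply/IH; exists v.
Qed.

Lemma is_path_rcons u w p d :
  is_path u (rcons p d) w <-> is_path u p (dart_src d) /\ dart_tgt d = w.
Proof.
rewrite -cats1 is_path_cat; split=> [[v [pv /= [-> <-]]] //|[pv <-]].
by exists (dart_src d).
Qed.

Lemma is_path_fun u v w p : is_path u p v -> is_path u p w -> v = w.
Proof. by elim: p u => [|d p IH] u /= => [-> //|[_ +] [_]]; apply: IH. Qed.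

Definition path_inv p := rev (map (@dart_rev X) p).

Lemma path_inv_cons d p : path_inv (d :: p) = rcons (path_inv p) (dart_rev d).
Proof. by rewrite /path_inv /= rev_cons. Qed.

Lemma path_inv_rcons d p : path_inv (rcons p d) = dart_rev d :: path_inv p.
Proof. by rewrite /path_inv map_rcons rev_rcons. Qed.

Lemma is_path_rev u v p : is_path u p v -> is_path v (path_inv p) u.
Proof.
elim: p u => [|d p IH] u /= => [->|[<- /IH pv]]; first by [].
by rewrite path_inv_cons is_path_rcons dart_tgt_rev.
Qed.

Lemma reduced_cat p d d' q : reduced (rcons p d ++ d' :: q) <->
  [/\ reduced (rcons p d), reduced (d' :: q) & d' <> dart_rev d].
Proof.
elim: p => [|d0 p IH] /=.
  by split=> [[? ?] //|[_ ? ?]].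
case: p IH => [|d1 p] /= IH; last first.
  by split=> [[? /IH[]] //|[[? ?] ? ?]]; split=> //; apply/IH.
by split=> [[? [? ?]] //|[[? _] ? ?]].
Qed.

Lemma reduced_rcons p d : reduced (rcons p d) -> reduced p.
Proof.
elim: p => [//|d0 p IH] /= [h /IH rp]; split=> //.
by case: p h {IH rp}.
Qed.

Lemma reduced_path_inv p : reduced p -> reduced (path_inv p).
Proof.
elim: p => [//|d p IH] [h /IH]; rewrite path_inv_cons.
case: p h {IH} => [//|d' p] h; rewrite path_inv_cons => rp.
rewrite -cats1; apply/reduced_cat; split=> //.
by rewrite dart_revK => e; apply: h; rewrite e.
Qed.

Lemma reduced_path_exists u v p : is_path u p v ->
  exists q, is_path u q v /\ reduced q.
Proof.
elim: p u => [|d p IH] u /=; first by exists [::].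
move=> [<- /IH[q [qv rq]]].
case: q qv rq => [|d' q] qv rq; first by exists [:: d].
have [e|ne] := pselect (d' = dart_rev d); last by exists [:: d, d' & q].
exists q; move: qv rq; rewrite e /= dart_tgt_rev => -[_ ?] [_ ?]; by split.
Qed.

Hypothesis tX : is_tree X.

(** At the first dart where the paths differ, the inverse of one followed by the other is a nonempty
    reduced loop. *)
Lemma reduced_path_unique u v p q : is_path u p v -> is_path u q v ->
  reduced p -> reduced q -> p = q.
Proof.
have [_ loop] := tX.
elim: p u q => [|d p IH] u q.
  by move=> /= -> qu _ rq; rewrite (loop v q).
case: q => [|d' q] pv qv rp rq.
  by move: pv; rewrite -qv => pv; rewrite (loop _ _ pv rp).
have [e|ne] := pselect (d = d').
  move: pv qv rp rq; rewrite e => -[_ pv] [_ qv] [_ rp] [_ rq].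
  by rewrite (IH _ _ pv qv rp rq).
have [] : path_inv (d :: p) ++ (d' :: q) <> [::].
  by rewrite path_inv_cons; case: (path_inv p).
apply: (loop v); first by apply/is_path_cat; exists u; split=> //; apply: is_path_rev.
rewrite path_inv_cons; apply/reduced_cat; split=> //.
  by rewrite -path_inv_cons; apply: reduced_path_inv.
by rewrite dart_revK => e; apply: ne.
Qed.

Lemma tree_path_exists u v : exists p, is_path u p v /\ reduced p.
Proof. by have [[_ /(_ u v)[p /reduced_path_exists]]] := tX. Qed.

Definition tree_path u v : seq (dart X) := sval (cid (tree_path_exists u v)).

Lemma tree_pathP u v : is_path u (tree_path u v) v.
Proof. by rewrite /tree_path; case: cid => p []. Qed.

Lemma tree_path_reduced u v : reduced (tree_path u v).
Proof. by rewrite /tree_path; case: cid => p []. Qed.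

Lemma tree_path_eq u v p : is_path u p v -> reduced p -> tree_path u v = p.
Proof.
move=> pv rp; apply: reduced_path_unique (tree_pathP u v) pv _ rp.
exact: tree_path_reduced.
Qed.

Lemma tree_path_inj o v w : tree_path o v = tree_path o w -> v = w.
Proof.
by move=> e; have := tree_pathP o w; rewrite -e; apply: is_path_fun; apply: tree_pathP.
Qed.

Lemma tree_path_rcons o v p d : tree_path o v = rcons p d ->
  dart_tgt d = v /\ p = tree_path o (dart_src d).
Proof.
move=> e; have := tree_pathP o v; rewrite e => /is_path_rcons[pv ->]; split=> //.
symmetry; apply: tree_path_eq => //; apply: (@reduced_rcons p d).
by rewrite -e; apply: tree_path_reduced.
Qed.

Definition outward o d :=
  tree_path o (dart_tgt d) = rcons (tree_path o (dart_src d)) d.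

(** Either [d] reverses the last dart of the path from the root to its source, or it extends that
    path to a reduced one. *)
Lemma outward_or_rev o d : outward o d \/ outward o (dart_rev d).
Proof.
have pP := tree_pathP o (dart_src d); have rP := tree_path_reduced o (dart_src d).
rewrite /outward dart_tgt_rev.
move: pP rP (@tree_path_rcons o (dart_src d)).
case: (lastP (tree_path o (dart_src d))) => [|p d'] pP rP h.
  left; apply: tree_path_eq; last by [].
  by move: pP => /= ->.
have [h1 h2] := h p d' erefl.
have [e|ne] := pselect (d = dart_rev d'); [right|left].
  by rewrite h2 e dart_revK.
apply: tree_path_eq; first by rewrite is_path_rcons.
by rewrite -cats1; apply/reduced_cat.
Qed.

Lemma outward_rev o d : outward o d -> ~ outward o (dart_rev d).
Proof.
rewrite /outward dart_tgt_rev => -> /(congr1 size); rewrite !size_rcons.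
lia.
Qed.

Lemma dart_src_neq_tgt d : dart_src d <> dart_tgt d.
Proof.
case: tX => _ loop e; have := loop (dart_src d) [:: d].
by rewrite /= -e => /(_ (conj erefl erefl) (conj I I)).
Qed.

Lemma parallel_dart d d' : dart_src d = dart_src d' -> dart_tgt d = dart_tgt d' -> d = d'.
Proof.
move=> es et; have rd (x : dart X) : reduced [:: x] by [].
suff [] : [:: d] = [:: d'] by [].
by apply: (reduced_path_unique (u := dart_src d) (v := dart_tgt d)).
Qed.

End Paths.

(** * Longest common prefixes of paths *)

Section CommonPrefix.
Variable A : Type.
Implicit Types p q r : seq A.

Fixpoint lcp p q : seq A :=
  match p, q with
  | x :: p', y :: q' => if `[< x = y >] then x :: lcp p' q' else [::]
  | _, _ => [::]
  end.

Lemma lcpC p q : lcp p q = lcp q p.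
Proof.
elim: p q => [|x p IH] [|y q] //=; case: asboolP => [->|ne].
  by rewrite asboolT // IH.
by rewrite asboolF // => e; apply: ne.
Qed.

Lemma lcp_id p : lcp p p = p.
Proof. by elim: p => //= x p ->; rewrite asboolT. Qed.

Lemma lcp_prefix p q : exists r, p = lcp p q ++ r.
Proof.
elim: p q => [|x p IH] [|y q] /=; try by eexists.
case: asboolP => [_|_]; last by eexists.
by have [r {1}->] := IH q; exists r.
Qed.

(** Combinatorial source of the four-point condition: taking lengths gives the ultrametric
    inequality for Gromov products. *)
Lemma lcp_ultra p q r : exists s,
  (lcp p r = lcp p q ++ s) \/ (lcp p r = lcp q r ++ s).
Proof.
elim: p q r => [|x p IH] [|y q] [|z r] /=; try by exists [::]; right.
- by exists [::]; left.
- by eexists; left.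
- case: (asboolP (x = y)) => [<-|_]; last by eexists; left.
  case: (asboolP (x = z)) => [_|_]; last by exists [::]; right.
  by have [s [->|->]] := IH q r; exists s; [left|right].
Qed.

Lemma lcp_cat p q r : lcp (p ++ q) r = lcp p r \/
  exists s, lcp (p ++ q) r = p ++ s /\ lcp p r = p.
Proof.
elim: p r => [|x p IH] [|z r] /=; try by left.
- by right; eexists.
- by right; eexists.
case: asboolP => [_|_]; last by left.
by have [->|[s [-> ->]]] := IH r; [left|right; exists s].
Qed.

End CommonPrefix.

(** * The metric of a simplicial tree *)

Section TreeDistance.
Variables (R : realType) (G : groupType) (T : metric_tree R G).
Let tT : is_tree T := tgraph_tree T.

Definition wt (p : seq (dart T)) : R := \sum_(d <- p) mlen T d.1.

Lemma wt_nil : wt [::] = 0. Proof. by rewrite /wt big_nil. Qed.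
Lemma wt_cat p q : wt (p ++ q) = wt p + wt q. Proof. by rewrite /wt big_cat. Qed.
Lemma wt_rcons p d : wt (rcons p d) = wt p + mlen T d.1.
Proof. by rewrite -cats1 wt_cat /wt big_seq1. Qed.
Lemma wt_ge0 p : 0 <= wt p.
Proof. by apply: sumr_ge0 => d _; apply/ltW/len_gt0. Qed.

Definition dart_pt (d : dart T) (s : R) : vertex T -> R :=
  edge_pt d.1 (if d.2 then s else 1 - s).

Lemma indic1E (u v : vertex T) : \1_[set u] v = (`[< v = u >]%:R : R).
Proof. by rewrite indicE; congr (_%:R); apply/idP/asboolP; rewrite in_setE. Qed.

Lemma dart_ptE d s v :
  dart_pt d s v = (1 - s) * `[< v = dart_src d >]%:R + s * `[< v = dart_tgt d >]%:R.
Proof.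
rewrite /dart_pt /edge_pt !indic1E /dart_tgt /dart_rev /dart_src.
by case: d => e [] //=; lra.
Qed.

Lemma dart_pt0 d : dart_pt d 0 = vertex_pt R (dart_src d).
Proof. by apply/funext => v; rewrite dart_ptE /vertex_pt indic1E; lra. Qed.

Lemma dart_pt1 d : dart_pt d 1 = vertex_pt R (dart_tgt d).
Proof. by apply/funext => v; rewrite dart_ptE /vertex_pt indic1E; lra. Qed.

Lemma vertex_pt_inj v w : vertex_pt (T := T) R v = vertex_pt R w -> v = w.
Proof.
move=> /(congr1 (fun f => f v)); rewrite /vertex_pt !indic1E asboolT //.
by case: asboolP => // _ /eqP; rewrite oner_eq0.
Qed.

Lemma dart_pt_vertex d s v : dart_pt d s = vertex_pt R v ->
  (s = 0 /\ v = dart_src d) \/ (s = 1 /\ v = dart_tgt d).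
Proof.
move=> e; have ne := @dart_src_neq_tgt _ tT d.
have := congr1 (fun f => f (dart_src d)) e.
have := congr1 (fun f => f (dart_tgt d)) e.
rewrite !dart_ptE /vertex_pt !indic1E !(asboolT erefl).
rewrite (asboolF ne) (@asboolF (dart_tgt d = _)); last by move=> /esym.
case: asboolP => [e1|_]; case: asboolP => [e2|_] /= h1 h2.
- by case: ne; rewrite e1 e2.
- by right; split; [clear -h1 h2; lra|].
- by left; split; [clear -h1 h2; lra|].
- by exfalso; clear -h1 h2; lra.
Qed.

(** An interior point has nonzero barycentric coordinates exactly at the two ends of its edge, and a
    tree has no parallel edges. *)
Lemma dart_pt_inj d d' s s' : 0 < s < 1 -> dart_pt d s = dart_pt d' s' ->
  (d' = d /\ s' = s) \/ (d' = dart_rev d /\ s' = 1 - s).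
Proof.
move=> /andP[s0 s1] e; have ne := @dart_src_neq_tgt _ tT d.
have := congr1 (fun f => f (dart_src d)) e.
have := congr1 (fun f => f (dart_tgt d)) e.
rewrite !dart_ptE !(asboolT erefl).
rewrite (asboolF ne) (@asboolF (dart_tgt d = dart_src d)); last by move=> /esym.
have fin (a b : vertex T) : `[< a = b >]%:R = 0 :> R \/ a = b /\ `[< a = b >]%:R = 1 :> R.
  by case: asboolP => ?; [right|left].
have [->|[e1 ->]] := fin (dart_tgt d) (dart_src d');
have [->|[e2 ->]] := fin (dart_tgt d) (dart_tgt d');
have [->|[e3 ->]] := fin (dart_src d) (dart_src d');
have [->|[e4 ->]] := fin (dart_src d) (dart_tgt d');
move=> /= h1 h2; try (by exfalso; clear -s0 s1 h1 h2; lra); try (by case: ne; congruence).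
- by left; split; [apply: parallel_dart|clear -s0 s1 h1 h2; lra].
- right; split; last by clear -s0 s1 h1 h2; lra.
  by apply: parallel_dart => //; rewrite dart_tgt_rev.
Qed.

Variable o : vertex T.
Let P := tree_path tT o.

(* The coordinates of x are a reduced path p from o and the distance h <= wt p
   from o to x along p; the last dart of p is the one whose half-open
   realization contains x. *)
Definition tree_coord (x : vertex T -> R) (p : seq (dart T)) (h : R) :=
  [/\ x = vertex_pt R o, p = [::] & h = 0] \/
  exists d s, [/\ outward tT o d, 0 < s <= 1, x = dart_pt d s,
    p = P (dart_tgt d) & h = wt (P (dart_src d)) + s * mlen T d.1].

Lemma tree_path_root : P o = [::].
Proof. exact: tree_path_eq. Qed.

Lemma coord_vertex v : tree_coord (vertex_pt R v) (P v) (wt (P v)).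
Proof.
move e : (P v) => q; case: (lastP q) e => {q} [|p d] e.
  left; split; rewrite ?wt_nil //; congr vertex_pt.
  by apply: (@tree_path_inj _ tT o); rewrite -/P e tree_path_root.
have [dv pd] := tree_path_rcons e; rewrite -/P in pd.
right; exists d, 1; rewrite ltr01 lexx; split=> //.
- by rewrite /outward -/P dv -pd.
- by rewrite dart_pt1 dv.
- by rewrite dv.
- by rewrite -pd wt_rcons mul1r.
Qed.

Lemma coord_dart d s : outward tT o d -> 0 < s <= 1 ->
  tree_coord (dart_pt d s) (P (dart_tgt d)) (wt (P (dart_src d)) + s * mlen T d.1).
Proof. by move=> od s01; right; exists d, s. Qed.

Lemma outward_edge e : exists d, outward tT o d /\ d.1 = e.
Proof.
by have [od|od] := outward_or_rev tT o (e, true);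
  eexists; split; [exact: od| |exact: od|].
Qed.

Lemma edge_pt_dart (d : dart T) s :
  edge_pt d.1 s = dart_pt d (if d.2 then s else 1 - s).
Proof. by rewrite /dart_pt; case: d.2; rewrite // opprB addrC subrK. Qed.

Lemma coord_exists x : realization (T := T) x -> exists p h, tree_coord x p h.
Proof.
case=> [[v ->]|[e [s [s01 ->]]]].
  by exists (P v), (wt (P v)); apply: coord_vertex.
have [d [od <-]] := outward_edge e; rewrite edge_pt_dart.
have : 0 <= (if d.2 then s else 1 - s) <= 1 by case: d.2; lra.
move: (if _ then _ else _) => {s01}t t01.
(* Half-open edges omit their end nearer to the root, so that end is treated as a vertex. *)
have [->|t0] := eqVneq t 0.
  by rewrite dart_pt0; do 2![eexists]; exact: coord_vertex.
exists (P (dart_tgt d)), (wt (P (dart_src d)) + t * mlen T d.1).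
apply: coord_dart => //.
by move: t01 => /andP[? ->]; rewrite lt_def t0 andbT.
Qed.

Lemma dart_pt_realization d s : 0 <= s <= 1 -> realization (T := T) (dart_pt d s).
Proof.
move=> s01; right; exists d.1, (if d.2 then s else 1 - s); split=> //.
by case: d.2; lra.
Qed.

Lemma coord_realization x p h : tree_coord x p h -> realization (T := T) x.
Proof.
case=> [[-> _ _]|[d [s [_ /andP[s0 s1] -> _ _]]]]; first by left; exists o.
by apply: dart_pt_realization; rewrite ltW.
Qed.

Lemma outward_inj d d' : outward tT o d -> outward tT o d' ->
  dart_tgt d = dart_tgt d' -> d = d'.
Proof.
by rewrite /outward => e e' ed; move: e; rewrite ed e' => /rcons_inj[_ ->].
Qed.

(** The root and the half-open outward edges partition the realization. *)
Lemma coord_fun x p h q k : tree_coord x p h -> tree_coord x q k -> p = q /\ h = k.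
Proof.
have ov d : outward tT o d -> dart_tgt d <> o.
  move=> od e; move: od; rewrite /outward e -/P tree_path_root.
  by case: (P _).
case=> [[-> -> ->]|[d [s [od s01 -> -> ->]]]].
  case=> [[_ -> ->] //|[d [s [od s01 /esym/dart_pt_vertex[[s0 _]|[_ e]] _ _]]]].
    by move: s01; rewrite s0 ltxx.
  by case: (ov _ od).
case=> [[/dart_pt_vertex[[s0 _]|[_ e]] _ _]|[d' [s' [od' s01' e -> ->]]]].
- by move: s01; rewrite s0 ltxx.
- by case: (ov _ od).
have [s1|s1] := eqVneq s 1.
  move: e; rewrite s1 dart_pt1 => /esym/dart_pt_vertex[[s0 _]|[s1' e]].
    by move: s01'; rewrite s0 ltxx.
  by rewrite (outward_inj od od' e) s1'.
have [|[-> ->] //|[ed _]] := dart_pt_inj _ e.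
  by move: s01 => /andP[-> s1']; rewrite lt_def eq_sym s1 s1'.
by case: (outward_rev od); rewrite -ed.
Qed.

Lemma coord_bounds x p h : tree_coord x p h -> 0 <= h <= wt p.
Proof.
case=> [[_ -> ->]|[d [s [od /andP[s0 s1] _ -> ->]]]]; first by rewrite wt_nil lexx.
rewrite /P od wt_rcons; have := wt_ge0 (P (dart_src d)).
by have := len_gt0 (mlen T) d.1; rewrite /P => ? ?; apply/andP; split; nra.
Qed.

Lemma coord_path x p h : tree_coord x p h -> exists v, p = P v.
Proof.
case=> [[_ -> _]|[d [s [_ _ _ -> _]]]]; last by eexists.
by exists o; rewrite tree_path_root.
Qed.

Lemma tree_path_prefix v p q : P v = p ++ q -> exists w, p = P w.
Proof.
elim/last_ind: q v p => [|q d IH] v p e; first by exists v; rewrite e cats0.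
move: e; rewrite -rcons_cat => /tree_path_rcons[_ e].
by apply: (IH (dart_src d)); rewrite /P e.
Qed.

(* The Gromov product at o of the points with coordinates (p, h) and (q, k). *)
Definition gprod (p : seq (dart T)) (h : R) (q : seq (dart T)) (k : R) : R :=
  Num.min h (Num.min k (wt (lcp p q))).

Lemma gprod_le p h q k :
  [/\ gprod p h q k <= h, gprod p h q k <= k & gprod p h q k <= wt (lcp p q)].
Proof. by rewrite /gprod !ge_min !lexx !orbT. Qed.

Lemma gprodC p h q k : gprod p h q k = gprod q k p h.
Proof. by rewrite /gprod lcpC minCA. Qed.

Lemma gprod_ultra p h q k r l :
  gprod p h q k <= gprod p h r l \/ gprod q k r l <= gprod p h r l.
Proof.
have [a1 a2 a3] := gprod_le p h q k; have [b1 b2 b3] := gprod_le q k r l.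
have [s lu] := lcp_ultra p q r; have s0 := wt_ge0 s.
have {lu}lu : gprod p h q k <= wt (lcp p r) \/ gprod q k r l <= wt (lcp p r).
  by case: lu => ->; rewrite wt_cat; [left|right]; lra.
rewrite {2 4}/gprod !le_min.
by have [?|?] := lerP (gprod p h q k) (gprod q k r l); [left|right];
  apply/and3P; split; case: lu; lra.
Qed.

Lemma gprod_id x p h : tree_coord x p h -> gprod p h p h = h.
Proof.
by move=> /coord_bounds/andP[_ hp]; rewrite /gprod lcp_id !min_l.
Qed.

(** Only the part of a path below height [h] matters, so a point may be described by any longer path
    through it. *)
Lemma gprod_prefix p q h r k : h <= wt p -> gprod (p ++ q) h r k = gprod p h r k.
Proof.
move=> hp; rewrite /gprod; have [->//|[s [-> ->]]] := lcp_cat p q r.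
rewrite minCA [RHS]minCA; congr (Num.min _ _).
by rewrite !min_l // wt_cat; have := wt_ge0 s; lra.
Qed.

Definition cdist p h q k : R := h + k - 2 * gprod p h q k.

Lemma cdist_four p h q k r l s m :
  cdist p h q k + cdist r l s m <= cdist p h r l + cdist q k s m \/
  cdist p h q k + cdist r l s m <= cdist p h s m + cdist q k r l.
Proof.
rewrite /cdist.
have := gprod_ultra p h r l q k; have := gprod_ultra p h s m q k.
have := gprod_ultra r l p h s m; have := gprod_ultra r l q k s m.
rewrite (gprodC r l p) (gprodC r l q) (gprodC s m q).
have [?|?] := lerP (gprod p h r l + gprod q k s m) (gprod p h s m + gprod q k r l).
  by move=> [?|?] [?|?] [?|?] [?|?]; left; lra.
by move=> [?|?] [?|?] [?|?] [?|?]; right; lra.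
Qed.

Lemma cdist_tri p h q k r l x : tree_coord x q k ->
  cdist p h r l <= cdist p h q k + cdist q k r l.
Proof.
move=> /gprod_id e; have := gprod_le p h q k; have := gprod_le q k r l.
by have := gprod_ultra p h q k r l; rewrite /cdist => -[?|?] [? ? ?] [? ? ?]; lra.
Qed.

Lemma chain_cat x y z L K : chain (T := T) x y L -> chain (T := T) y z K ->
  chain (T := T) x z (L + K).
Proof.
move=> c; elim: c z K => [{}x z K|e s s' {}y {}L s0 s1 _ IH z K /IH c].
  by rewrite add0r.
by rewrite -addrA; apply: chain_cons.
Qed.

Lemma chain_edge e s s' : 0 <= s <= 1 -> 0 <= s' <= 1 ->
  chain (T := T) (edge_pt e s) (edge_pt e s') (`|s - s'| * mlen T e).
Proof.
move=> s0 s1; rewrite -[X in chain _ _ X]addr0; apply: chain_cons => //.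
exact: chain_nil.
Qed.

Lemma chain_sym x y L : chain (T := T) x y L -> chain (T := T) y x L.
Proof.
elim=> [{}x|e s s' {}y {}L s0 s1 _ IH]; first exact: chain_nil.
by rewrite addrC; apply: chain_cat IH _; rewrite distrC; apply: chain_edge.
Qed.

Lemma chain_dart d s s' : 0 <= s' -> s' <= s -> s <= 1 ->
  chain (T := T) (dart_pt d s) (dart_pt d s') ((s - s') * mlen T d.1).
Proof.
move=> s0 s1 s2; rewrite /dart_pt; case: d.2.
  by rewrite -[s - s']ger0_norm; [apply: chain_edge; lra|lra].
rewrite -[s - s']ger0_norm; last by lra.
rewrite distrC (_ : s' - s = (1 - s) - (1 - s')); last by lra.
by apply: chain_edge; lra.
Qed.

Lemma chain_ge0 x y L : chain (T := T) x y L -> 0 <= L.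
Proof.
by elim=> // *; apply: addr_ge0 => //; apply: mulr_ge0 => //; apply/ltW/len_gt0.
Qed.

Lemma coord_chain x z p h q k r : tree_coord x p h -> tree_coord z q k -> p = q ++ r ->
  k <= h -> chain (T := T) x z (h - k).
Proof.
elim/last_ind: p x h r => [|p d IH] x h r cx cz.
  case: q cz => // cz _ kh.
  case: cx => [[-> _ ->]|[d [s [od _ _ + _]]]]; last first.
    by rewrite /P od; case: (tree_path _ _ _).
  case: cz => [[-> _ ->]|[d [s [od _ _ + _]]]]; last first.
    by rewrite /P od; case: (tree_path _ _ _).
  by rewrite subr0; apply: chain_nil.
case: cx => [[_ + _]|]; first by case: p {IH}.
case=> d' [s [od' /andP[s0 s1] -> + ->]].
rewrite /P od' => /rcons_inj[ep0 ed]; rewrite -{d'}ed -/P in od' ep0 *.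
rewrite {p}ep0 in IH *.
case: (lastP r) => [|r' d'] {r}.
  rewrite cats0 => eq; case: cz => [[_ + _]|]; first by rewrite -eq; case: (P _).
  case=> d' [s' [od'' /andP[s0' s1'] -> + ->]]; rewrite -eq /P od'' => /rcons_inj[ep ed].
  rewrite -ed -/P => kh.
  rewrite (_ : _ - _ = (s - s') * mlen T d.1); last by lra.
  apply: chain_dart => //; first exact: ltW.
  by move: kh; have := len_gt0 (mlen T) d.1; nra.
rewrite -rcons_cat => /rcons_inj[ep _] kh.
have kw : k <= wt (P (dart_src d)).
  by rewrite ep wt_cat; have /andP[_] := coord_bounds cz; have := wt_ge0 r'; lra.
have c1 : chain (T := T) (dart_pt d s) (vertex_pt R (dart_src d)) ((s - 0) * mlen T d.1).
  by rewrite -dart_pt0; apply: chain_dart => //; apply: ltW.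
have := IH _ _ r' (coord_vertex _) cz ep kw.
move/(chain_cat c1); congr (chain _ _ _); lra.
Qed.

Lemma coord_point v h : 0 <= h <= wt (P v) ->
  exists z p q, tree_coord z p h /\ P v = p ++ q.
Proof.
move e : (P v) => p; elim/last_ind: p v e => [|p d IH] v e.
  rewrite wt_nil -eq_le => /eqP <-.
  by exists (vertex_pt R o), [::], [::]; split=> //; left.
have [dv pd] := tree_path_rcons e; rewrite -/P in pd.
have l0 := len_gt0 (mlen T) d.1.
rewrite wt_rcons => /andP[h0 h1].
have [hp|hp] := leP h (wt p).
  have [||z [q [r [cz er]]]] := IH (dart_src d); rewrite ?h0 //.
  by exists z, q, (rcons r d); rewrite -rcons_cat -er.
have od : outward tT o d by rewrite /outward -/P dv -pd.
exists (dart_pt d ((h - wt p) / mlen T d.1)), (rcons p d), [::].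
rewrite cats0; split=> //; rewrite -e -dv.
rewrite (_ : tree_coord _ _ h =
  tree_coord (dart_pt d ((h - wt p) / mlen T d.1)) (P (dart_tgt d))
  (wt (P (dart_src d)) + ((h - wt p) / mlen T d.1) * mlen T d.1)); last first.
  by congr tree_coord; rewrite -pd divfK ?gt_eqF //; lra.
apply: coord_dart => //; rewrite divr_gt0 ?subr_gt0 //=.
by rewrite ler_pdivrMr // mul1r; lra.
Qed.

(** Both points descend towards the root until their paths join, at the height of the Gromov
    product. *)
Lemma coord_cdist_chain x y p h q k : tree_coord x p h -> tree_coord y q k ->
  chain (T := T) x y (cdist p h q k).
Proof.
move=> cx cy; have [v pv] := coord_path cx; have [r1 e1] := lcp_prefix p q.
have [r2 e2] := lcp_prefix q p.
have [w ew] : exists w, lcp p q = P w by apply: (@tree_path_prefix v _ r1); rewrite -pv.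
have [g1 g2 g3] := gprod_le p h q k.
have [|z [s [r [cz es]]]] := @coord_point w (gprod p h q k).
  rewrite -ew g3 andbT /gprod !le_min wt_ge0.
  by have /andP[-> _] := coord_bounds cx; have /andP[-> _] := coord_bounds cy.
have c1 : chain (T := T) x z (h - gprod p h q k).
  by apply: (coord_chain cx cz (r := r ++ r1)) => //; rewrite e1 ew es catA.
have c2 : chain (T := T) y z (k - gprod p h q k).
  by apply: (coord_chain cy cz (r := r ++ r2)) => //; rewrite e2 lcpC ew es catA.
by have := chain_cat c1 (chain_sym c2); congr (chain _ _ _); rewrite /cdist; lra.
Qed.

Lemma cdist_dart d s s' p h q k : outward tT o d -> 0 <= s <= 1 -> 0 <= s' <= 1 ->
  tree_coord (dart_pt d s) p h -> tree_coord (dart_pt d s') q k ->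
  cdist p h q k <= `|s - s'| * mlen T d.1.
Proof.
move=> od s01 s'01 cx cy; have l0 := len_gt0 (mlen T) d.1.
have aux u r l : 0 <= u <= 1 -> tree_coord (dart_pt d u) r l ->
    l = wt (P (dart_src d)) + u * mlen T d.1 /\ exists t, P (dart_tgt d) = r ++ t.
  move=> u01 cu; have [u0|u0] := eqVneq u 0.
    move: cu; rewrite u0 dart_pt0 => cu.
    have [-> ->] := coord_fun cu (coord_vertex _); rewrite mul0r addr0; split=> //.
    by exists [:: d]; rewrite /P od cats1.
  have u01' : 0 < u <= 1 by move: u01 => /andP[? ->]; rewrite lt_def u0 andbT.
  have [-> ->] := coord_fun cu (coord_dart od u01'); split=> //.
  by exists [::]; rewrite cats0.
have [eh [t1 e1]] := aux _ _ _ s01 cx; have [ek [t2 e2]] := aux _ _ _ s'01 cy.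
have /andP[h0 hp] := coord_bounds cx; have /andP[k0 kq] := coord_bounds cy.
have {h0 k0} -> : cdist p h q k = h + k - 2 * Num.min h k.
  rewrite /cdist -(gprod_prefix t1 q k hp) -e1 gprodC -(gprod_prefix t2 _ _ kq) -e2.
  rewrite /gprod lcp_id [Num.min h (wt _)]min_l; first by rewrite minC.
  by rewrite e1 wt_cat; have := wt_ge0 t1; lra.
rewrite eh ek; have [?|?] := lerP s s'.
  by rewrite min_l; [lra|nra].
by rewrite min_r; [lra|nra].
Qed.

(** Each piece of a chain stays in one edge, where [cdist_dart] applies; [cdist_tri] adds the
    pieces. Hence the infimum defining [tdist] is attained by the descending chain. *)
Lemma cdist_le_chain x y L p h q k : chain (T := T) x y L ->
  tree_coord x p h -> tree_coord y q k -> cdist p h q k <= L.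
Proof.
move=> c; elim: c p h => [{}x|e s s' {}y {}L s01 s'01 _ IH] p h cx cy.
  by have [-> ->] := coord_fun cx cy; rewrite /cdist (gprod_id cy); lra.
have [r [l cr]] : exists r l, tree_coord (edge_pt e s') r l.
  by apply: coord_exists; right; exists e, s'.
apply: le_trans (cdist_tri p h q k cr) _; apply: lerD; last exact: IH.
have [d [od ed]] := outward_edge e.
move: cx cr; rewrite -ed !edge_pt_dart => cx cr.
have -> : `|s - s'| = `|(if d.2 then s else 1 - s) - (if d.2 then s' else 1 - s')|.
  case: d.2 => //; rewrite distrC; congr (`|_|); ring.
by apply: cdist_dart od _ _ cx cr; case: d.2; lra.
Qed.

Lemma tdist_coord x y p h q k : tree_coord x p h -> tree_coord y q k ->
  tdist (T := T) x y = cdist p h q k.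
Proof.
move=> cx cy; apply/eqP; rewrite eq_le; apply/andP; split.
  apply: ge_inf; last exact: coord_cdist_chain.
  by exists 0 => L /chain_ge0.
apply: lb_le_inf; first by exists (cdist p h q k); apply: coord_cdist_chain.
by move=> L c; apply: cdist_le_chain c cx cy.
Qed.

End TreeDistance.

Section TreeAction.
Variables (G : groupType) (T : gtree G).
Let tT : is_tree T := tgraph_tree T.

Definition dact (g : G) (d : dart T) : dart T := (eact g d.1, d.2).

Lemma dact_src g d : dart_src (dact g d) = vact g (dart_src d).
Proof. by case: d => e []; rewrite /dart_src /= ?vact_src ?vact_tgt. Qed.

Lemma dact_tgt g d : dart_tgt (dact g d) = vact g (dart_tgt d).
Proof. by rewrite /dart_tgt -dact_src. Qed.

Lemma is_path_act g u v p :
  is_path u p v -> is_path (vact g u) (map (dact g) p) (vact g v).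
Proof.
elim: p u => [|d p IH] u /=; first by move=> ->.
by move=> [<- /IH]; rewrite dact_src dact_tgt.
Qed.

Lemma eact_inj g : injective (eact (g0 := T) g).
Proof. by move=> e e' /(congr1 (eact g^-1%g)); rewrite -!eactM mulVg !eact1. Qed.

Lemma reduced_act g p : reduced p -> reduced (map (dact g) p).
Proof.
elim: p => //= d p IH [h /IH rp]; split=> //.
case: p h {IH rp} => //= d' _ h [/eact_inj e1 e2]; apply: h.
by case: d d' e1 e2 => [e b] [e' b'] /= -> ->.
Qed.

Lemma tree_path_act g u v :
  tree_path tT (vact g u) (vact g v) = map (dact g) (tree_path tT u v).
Proof.
apply: tree_path_eq; first by apply: is_path_act; apply: tree_pathP.
by apply: reduced_act; apply: tree_path_reduced.
Qed.

End TreeAction.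

(** * The realization as a real tree with an isometric action *)

Section TreePoints.
Variables (R : realType) (G : groupType) (T : metric_tree R G).
Let tT : is_tree T := tgraph_tree T.

(** The descent from [x] towards the root follows the geodesic to [y] up to the branch point, whence
    the bound on [r]. *)
Lemma coord_truncate o x y p h q k r :
  tree_coord (T := T) o x p h -> tree_coord (T := T) o y q k ->
  0 <= r <= h - gprod p h q k ->
  exists z, [/\ realization z, tdist (T := T) x z = r &
    tdist (T := T) z y = tdist (T := T) x y - r].
Proof.
move=> cx cy /andP[r0 rh]; have [g1 g2 g3] := gprod_le p h q k.
have /andP[h0 hp] := coord_bounds cx; have /andP[k0 kq] := coord_bounds cy.
have [v pv] := coord_path cx.
have g0 : 0 <= gprod p h q k by rewrite /gprod !le_min h0 k0 wt_ge0.
have [|z [s [t [cz est]]]] := @coord_point _ _ T o v (h - r).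
  by rewrite -pv; apply/andP; split; lra.
rewrite -pv in est; have /andP[_ hs] := coord_bounds cz.
exists z; split; first exact: coord_realization cz.
  rewrite (tdist_coord cx cz) /cdist gprodC -(gprod_prefix t _ _ hs) -est.
  rewrite /gprod lcp_id min_l; first lra.
  by rewrite le_min; apply/andP; split; lra.
rewrite (tdist_coord cz cy) (tdist_coord cx cy) /cdist.
rewrite -(gprod_prefix t q k hs) -est.
suff -> : gprod p (h - r) q k = gprod p h q k by lra.
move: g1 g2 g3 rh; rewrite /gprod; set m := Num.min k _ => g1 g2 g3 rh.
have [hm|mh] := lerP h m; last by rewrite min_r //; move: rh; rewrite min_r; lra.
by move: rh; rewrite min_l // => rh; rewrite min_l; lra.
Qed.

(** Distance 0 forces equal heights, not above the common prefix. As a point lies strictly above the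
    source of its last dart, the prefix contains that dart, so both paths coincide. *)
Lemma coord_eq0 o x y p h q k :
  tree_coord (T := T) o x p h -> tree_coord (T := T) o y q k ->
  cdist p h q k = 0 -> x = y.
Proof.
move=> cx cy; have [g1 g2 g3] := gprod_le p h q k; rewrite /cdist => e.
have ehk : h = k by lra.
have hw : h <= wt (lcp p q) by lra.
have last_lcp (p' s : seq (dart T)) d : (exists r, rcons p' d = s ++ r) ->
    wt p' < wt s -> s = rcons p' d.
  move=> [r]; case: (lastP r) => [|r' d']; first by rewrite cats0.
  rewrite -rcons_cat => /rcons_inj[-> _]; rewrite wt_cat.
  by have := wt_ge0 r' => ? ?; exfalso; lra.
case: cx => [[-> ep eh]|[d [s [od /andP[s0 s1] -> ep eh]]]].
  case: cy => [[-> _ _] //|[d [s [od /andP[s0 s1] -> eq ek]]]].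
  have := wt_ge0 (tree_path (tgraph_tree T) o (dart_src d)).
  by have := len_gt0 (mlen T) d.1 => ? ?; exfalso; nra.
case: cy => [[-> _ ek]|[d' [s' [od' /andP[s0' s1'] -> eq ek]]]].
  have := wt_ge0 (tree_path (tgraph_tree T) o (dart_src d)).
  by have := len_gt0 (mlen T) d.1 => ? ?; exfalso; nra.
have l0 := len_gt0 (mlen T) d.1; have l0' := len_gt0 (mlen T) d'.1.
move: ep eq; rewrite od od' => ep eq.
have e1 : lcp p q = p.
  rewrite {2}ep; apply: last_lcp; first by rewrite -ep; apply: lcp_prefix.
  by apply: lt_le_trans hw; rewrite eh; nra.
have e2 : lcp p q = q.
  rewrite {2}eq; apply: last_lcp; first by rewrite -eq lcpC; apply: lcp_prefix.
  by apply: lt_le_trans hw; rewrite ehk ek; nra.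
move: e2; rewrite e1 ep eq => /rcons_inj[e2 ed].
rewrite -ed in ek *; congr dart_pt.
by apply: (mulIf (lt0r_neq0 l0)); lra.
Qed.

Definition tree_point := {x : vertex T -> R | realization x}.

Definition pdist (x y : tree_point) : R := tdist (T := T) (sval x) (sval y).

Lemma tree_metric_pdist : tree_metric pdist.
Proof.
have [[inh _] _] := tT; case: inh => o.
have cor (x : tree_point) : exists p h, tree_coord (T := T) o (sval x) p h.
  by case: x => x rx; apply: coord_exists.
have dC x y : pdist x y = pdist y x.
  have [p [h cx]] := cor x; have [q [k cy]] := cor y.
  by rewrite /pdist (tdist_coord cx cy) (tdist_coord cy cx) /cdist gprodC; lra.
split=> //.
- move=> x; have [p [h cx]] := cor x.
  by rewrite /pdist (tdist_coord cx cx) /cdist (gprod_id cx); lra.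
- move=> x y; have [p [h cx]] := cor x; have [q [k cy]] := cor y.
  rewrite /pdist (tdist_coord cx cy) => /(coord_eq0 cx cy).
  by case: x y {cx cy} => x rx [y ry] /= e; apply: eq_exist.
- move=> x y r; have [p [h cx]] := cor x; have [q [k cy]] := cor y.
  rewrite {1}/pdist (tdist_coord cx cy) /cdist => /andP[r0 rd].
  have [rm|rm] := leP r (h - gprod p h q k).
    have [|z [rz xz zy]] := @coord_truncate o _ _ _ _ _ _ r cx cy.
      by rewrite r0.
    by exists (exist _ z rz).
  (* Beyond the branch point the geodesic is reached by descending from [y] instead. *)
  have [|z [rz yz zx]] := @coord_truncate o _ _ _ _ _ _ (pdist x y - r) cy cx.
    rewrite /pdist (tdist_coord cx cy) /cdist (gprodC q).
    by apply/andP; split; lra.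
  exists (exist _ z rz); rewrite dC [in X in _ /\ X]dC /pdist /= zx yz -!/(pdist _ _).
  by rewrite (dC y x); split; lra.
- move=> x y z w; have [p [h cx]] := cor x; have [q [k cy]] := cor y.
  have [r [l cz]] := cor z; have [s [m cw]] := cor w; rewrite /pdist.
  rewrite (tdist_coord cx cy) (tdist_coord cz cw) (tdist_coord cx cz) (tdist_coord cy cw).
  by rewrite (tdist_coord cx cw) (tdist_coord cy cz); apply: cdist_four.
Qed.

Lemma tdist_vertex (v w : vertex T) :
  tdist (T := T) (vertex_pt R v) (vertex_pt R w) = wt (tree_path tT v w).
Proof.
have c0 : tree_coord (T := T) v (vertex_pt R v) [::] 0 by left.
rewrite (tdist_coord c0 (coord_vertex v w)) /cdist add0r.
rewrite /gprod min_l ?mulr0 ?subr0 //.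
by rewrite le_min !wt_ge0.
Qed.

Lemma tdist_vertex_between (o v w : vertex T) :
  lcp (tree_path tT o v) (tree_path tT o w) = [::] ->
  tdist (T := T) (vertex_pt R v) (vertex_pt R w) =
  tdist (T := T) (vertex_pt R o) (vertex_pt R v) +
  tdist (T := T) (vertex_pt R o) (vertex_pt R w).
Proof.
move=> e; rewrite (tdist_coord (coord_vertex o v) (coord_vertex o w)) !tdist_vertex.
rewrite /cdist /gprod e wt_nil -/tT min_r ?min_r ?wt_ge0 //; lra.
Qed.

Lemma pact_vertex g (v : vertex T) : pact g (vertex_pt R v) = vertex_pt R (vact g v).
Proof.
apply/funext => w; rewrite /pact /vertex_pt !indic1E; congr (_%:R).
congr (nat_of_bool _); apply/asboolP/asboolP => [<-|->].
  by rewrite -vactM mulgV vact1.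
by rewrite -vactM mulVg vact1.
Qed.

Lemma pact_edge g (e : edge T) (s : R) : pact g (edge_pt e s) = edge_pt (eact g e) s.
Proof.
apply/funext => w; have h (v : vertex T) := congr1 (fun f => f w) (pact_vertex g v).
by rewrite /edge_pt vact_src vact_tgt -[in RHS]/(vertex_pt R _ w)
  -[in X in _ + _ * X]/(vertex_pt R _ w) -!h.
Qed.

Lemma pact1 (x : vertex T -> R) : pact 1%g x = x.
Proof. by apply/funext => v; rewrite /pact invg1 vact1. Qed.

Lemma pactM g h (x : vertex T -> R) : pact (g * h)%g x = pact g (pact h x).
Proof. by apply/funext => v; rewrite /pact invgM vactM. Qed.

Lemma realization_pact g (x : vertex T -> R) : realization x -> realization (pact g x).
Proof.
case=> [[v ->]|[e [s [s01 ->]]]]; first by left; exists (vact g v); rewrite pact_vertex.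
by right; exists (eact g e), s; rewrite pact_edge.
Qed.

Lemma chain_pact g x y L : chain (T := T) x y L -> chain (T := T) (pact g x) (pact g y) L.
Proof.
elim=> [{}x|e s s' {}y {}L s0 s1 _ IH]; first exact: chain_nil.
by rewrite pact_edge -(len_act (mlen T) g); apply: chain_cons => //; rewrite -pact_edge.
Qed.

Lemma tdist_pact g x y : tdist (T := T) (pact g x) (pact g y) = tdist (T := T) x y.
Proof.
rewrite /tdist; congr inf; apply/seteqP; split=> L /= c; last exact: chain_pact.
by have := chain_pact g^-1%g c; rewrite -!pactM mulVg !pact1.
Qed.

Definition tree_point_act g (x : tree_point) : tree_point :=
  exist _ (pact g (sval x)) (realization_pact g (svalP x)).

Lemma tree_point_act1 x : tree_point_act 1%g x = x.
Proof. by case: x => x rx; apply: eq_exist; rewrite /= pact1. Qed.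

Lemma tree_point_actM g h x :
  tree_point_act (g * h)%g x = tree_point_act g (tree_point_act h x).
Proof. by apply: eq_exist; rewrite /= pactM. Qed.

Lemma pdist_act g x y : pdist (tree_point_act g x) (tree_point_act g y) = pdist x y.
Proof. exact: tdist_pact. Qed.

(** A fixed point inside an edge would make [g] fix or invert the edge; two distinct fixed vertices
    would make it fix the path between them. *)
Lemma fixed_point_unique g x y : (forall e : edge T, estab e = [set 1%g]) ->
  g != 1%g -> tree_point_act g x = x -> tree_point_act g y = y -> x = y.
Proof.
move=> stab1 g1.
have nofix e : eact (g0 := T) g e <> e.
  by move=> ge; move/eqP: g1; apply; have : estab e g by []; rewrite stab1.
have vert z : tree_point_act g z = z -> exists v, sval z = vertex_pt R v /\ vact g v = v.
  case: z => z rz /(congr1 sval) /= gz.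
  case: rz gz => [[v ->]|[e [s [s01 ->]]]].
    by rewrite pact_vertex => /vertex_pt_inj ?; exists v.
  rewrite pact_edge => gz.
  have [s0|s0] := eqVneq s 0.
    move: gz; rewrite s0 -[edge_pt e 0]/(dart_pt (e, true) 0).
    rewrite -[edge_pt _ 0]/(dart_pt (eact g e, true) 0) !dart_pt0 => /vertex_pt_inj.
    by rewrite /dart_src /= vact_src; exists (src e).
  have [s1|s1] := eqVneq s 1.
    move: gz; rewrite s1 -[edge_pt e 1]/(dart_pt (e, true) 1).
    rewrite -[edge_pt _ 1]/(dart_pt (eact g e, true) 1) !dart_pt1 => /vertex_pt_inj.
    by rewrite /dart_tgt /dart_src /= vact_tgt; exists (tgt e).
  have [||[/esym + _]|[+ _]] := @dart_pt_inj _ _ T (eact g e, true) (e, true) s s.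
  - by move: s01 => /andP[? ?]; rewrite !lt_def s0 eq_sym s1 /=; apply/andP.
  - exact: gz.
  - by move=> [/nofix].
  - by case.
move=> /vert[v [ev gv]] /vert[w [ew gw]].
have e : v = w.
  have := tree_path_act g v w; rewrite gv gw.
  case: (tree_path tT v w) (tree_pathP tT v w) => [|d p] //= _ [] ed.
  by case: (nofix d.1); rewrite {2}ed.
case: x y ev ew => x rx [y ry] /= ev ew; apply: eq_exist.
by rewrite /= ev ew e.
Qed.

End TreePoints.

(** * Translation lengths and axes *)

Section MinimalDisplacement.
Variables (R : realType) (G : groupType) (T : gtree G).
Let tT : is_tree T := tgraph_tree T.

(** The condition says that the path from [v] to [g v] is cyclically reduced. If it is not, its last
    dart is the reverse of the [g]-image of its first dart [d1], and replacing [v] by the end of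
    [d1] removes both darts. A path of one dart cannot fail, since there are no inversions. *)
Lemma axis_vertex g : exists v : vertex T,
  lcp (tree_path tT (vact g v) v) (tree_path tT (vact g v) (vact g (vact g v))) = [::].
Proof.
have [[inh _] _] := tT; case: inh => v0.
have [n le_n] : exists n, (size (tree_path tT v0 (vact g v0)) <= n)%N by eexists.
elim: n v0 le_n => [|n IH] v.
  rewrite leqn0 => /nilP e; exists v.
  have := tree_pathP tT v (vact g v); rewrite e /= => <-.
  by rewrite (@tree_path_eq _ tT v v [::]).
move=> le_n.
have rv : tree_path tT (vact g v) v = path_inv (tree_path tT v (vact g v)).
  apply: tree_path_eq; first by apply: is_path_rev; apply: tree_pathP.
  by apply: reduced_path_inv; apply: tree_path_reduced.
have [|ne] := pselect (lcp (tree_path tT (vact g v) v)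
   (tree_path tT (vact g v) (vact g (vact g v))) = [::]); first by exists v.
have pP := tree_pathP tT v (vact g v); have rP := tree_path_reduced tT v (vact g v).
move: ne le_n; rewrite rv tree_path_act.
case: (tree_path tT v (vact g v)) pP rP => [|d1 p] pP rP //.
case: (lastP p) pP rP => [|p' dl] {p} pP rP.
  rewrite /path_inv /=; case: asboolP => [e _ _|_ []//].
  by have := congr1 snd e; case: (d1) => ? [].
rewrite -rcons_cons path_inv_rcons /=; case: asboolP => [e _ le_n|_ []//].
apply: (IH (dart_tgt d1)); move: pP => [_ /is_path_rcons[pP _]].
rewrite (@tree_path_eq _ tT _ _ p').
  by move: le_n; rewrite /= size_rcons ltnS => /ltnW.
  by rewrite -dact_tgt -e dart_tgt_rev.
by apply: (@reduced_rcons _ p' dl); case: rP.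
Qed.

(** The vertex [v] and the path [q] precede the lengths [c], which makes translation length linear
    on a simplex. For [v] as in [axis_vertex], [g v] is halfway from [v] to [g (g v)], and
    [displacement_twice] shows that no point moves less. *)
Lemma minimal_displacement g : exists (v : vertex T) (q : seq (edge T)),
  forall c : lengths R T,
    tdist (T := MetricTree c) (vertex_pt R v) (vertex_pt R (vact g v)) =
      \sum_(e <- q) c e /\
    forall x : tree_point (MetricTree c),
      \sum_(e <- q) c e <= pdist x (tree_point_act g x).
Proof.
have [v ev] := axis_vertex g; exists v, (map fst (tree_path tT v (vact g v))) => c.
pose Tc := MetricTree c.
have dv : tdist (T := Tc) (vertex_pt R v) (vertex_pt R (vact g v)) =
    \sum_(e <- map fst (tree_path tT v (vact g v))) c e.
  by rewrite tdist_vertex /wt big_map.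
split=> // x; rewrite -dv.
have rv w : realization (vertex_pt R w : vertex Tc -> R) by left; exists w.
pose y : tree_point Tc := exist _ _ (rv v).
have := displacement_twice (tree_metric_pdist Tc) (pdist_act g) y x.
have yv : sval (tree_point_act g y) = vertex_pt R (vact g v).
  exact: (pact_vertex (T := Tc)).
have yyv : sval (tree_point_act g (tree_point_act g y)) =
   vertex_pt R (vact g (vact g v)) by rewrite -!(pact_vertex (T := Tc)).
have tw := pdist_act g y (tree_point_act g y).
have dC := tm_sym (tree_metric_pdist Tc) (tree_point_act g y) y.
have := @tdist_vertex_between _ _ Tc _ _ _ ev.
move: tw dC; rewrite /pdist yv yyv /=; lra.
Qed.

End MinimalDisplacement.

(** * Equivariant Lipschitz maps *)

Section PiecewiseLinear.
Variables (R : realType) (G : groupType) (T T' : metric_tree R G).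
Variable f : vertex T -> tree_point T'.
Hypothesis f_act : forall g v, f (vact g v) = tree_point_act g (f v).

Let tm := tree_metric_pdist T'.

Definition on_segment (p q : tree_point T') (s : R) (z : tree_point T') :=
  pdist p z = s * pdist p q /\ pdist z q = (1 - s) * pdist p q.

Lemma on_segment_between p q s z : on_segment p q s z -> between (@pdist R G T') p z q.
Proof. by rewrite /between => -[-> ->]; lra. Qed.

Lemma on_segment_dist p q s z s' z' : on_segment p q s z -> on_segment p q s' z' ->
  pdist z z' <= `|s - s'| * pdist p q.
Proof.
move=> /[dup] /on_segment_between b [pz zq] [pz' zq'].
have d0 := tm_ge0 tm p q.
have := ler_norm (s - s'); have := ler_norm (s' - s); rewrite (distrC s' s).
have := tm_sym tm q z'; have := tm_sym tm q z.
by case: (between_le tm z' b); nra.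
Qed.

Lemma on_segment_unique p q s z z' : on_segment p q s z -> on_segment p q s z' -> z = z'.
Proof.
move=> oz oz'; have := on_segment_dist oz oz'.
rewrite subrr normr0 mul0r => le0; apply: (tm_eq0 tm).
by have := tm_ge0 tm z z'; lra.
Qed.

Lemma on_segment_exists p q s : 0 <= s <= 1 -> exists z, on_segment p q s z.
Proof.
move=> s01; have d0 := tm_ge0 tm p q.
have [|z [pz zq]] := @tm_geodesic _ _ _ tm p q (s * pdist p q).
  by apply/andP; split; nra.
by exists z; split=> //; rewrite zq; lra.
Qed.

Definition linear_extension (F : tree_point T -> tree_point T') :=
  (forall x v, sval x = vertex_pt R v -> F x = f v) /\
  (forall x e s, 0 <= s <= 1 -> sval x = edge_pt e s ->
     on_segment (f (src e)) (f (tgt e)) s (F x)).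

(** A vertex is an end of several edges, but all these descriptions prescribe the same image; an
    interior point has a single description. *)
Lemma linear_extension_exists : exists F, linear_extension F.
Proof.
suff /choice[F FP] : forall x : tree_point T, exists y,
    (forall v, sval x = vertex_pt R v -> y = f v) /\
    (forall e s, 0 <= s <= 1 -> sval x = edge_pt e s ->
       on_segment (f (src e)) (f (tgt e)) s y).
  by exists F; split=> [x|x e s]; have [] := FP x; auto.
have xx := tm_refl tm.
have vert v : exists y, (forall w, vertex_pt R v = vertex_pt R w -> y = f w) /\
    (forall e s, 0 <= s <= 1 -> vertex_pt R v = edge_pt e s ->
       on_segment (f (src e)) (f (tgt e)) s y).
  exists (f v); split=> [w /vertex_pt_inj -> //|e s _ ve].
  have [[s0 ->]|[s1 ->]] := @dart_pt_vertex _ _ T (e, true) s v (esym ve).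
    by rewrite /dart_src /= /on_segment s0 xx; split; lra.
  by rewrite /dart_tgt /dart_src /= /on_segment s1 xx; split; lra.
case=> x /= [[v ->]|[e [s [s01 ->]]]]; first exact: vert.
have [s0|s0] := eqVneq s 0.
  rewrite s0 -[edge_pt e 0]/(dart_pt (e, true) 0) dart_pt0; exact: vert.
have [s1|s1] := eqVneq s 1.
  rewrite s1 -[edge_pt e 1]/(dart_pt (e, true) 1) dart_pt1; exact: vert.
have [y yP] := on_segment_exists (f (src e)) (f (tgt e)) s01.
exists y; split=> [v ev|e' s' s01' ee].
  have [[se _]|[se _]] := @dart_pt_vertex _ _ T (e, true) s v ev.
    by rewrite se eqxx in s0.
  by rewrite se eqxx in s1.
have [||[[->] ->]|[]] := @dart_pt_inj _ _ T (e, true) (e', true) s s' => //.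
by move: s01 => /andP[? ?]; rewrite !lt_def s0 eq_sym s1 /=; apply/andP.
Qed.

Lemma linear_extension_act F g x : linear_extension F ->
  F (tree_point_act g x) = tree_point_act g (F x).
Proof.
move=> [Fv Fe]; case: (svalP x) => [[v xv]|[e [s [s01 xe]]]].
  rewrite (Fv _ _ xv) -f_act; apply: Fv.
  by rewrite /= xv pact_vertex.
have h := Fe _ _ _ s01 xe.
have h' : on_segment (f (src (eact g e))) (f (tgt (eact g e))) s (F (tree_point_act g x)).
  by apply: Fe => //=; rewrite xe pact_edge.
apply: (on_segment_unique h').
by move: h; rewrite /on_segment vact_src vact_tgt !f_act !pdist_act.
Qed.

Lemma tdist_chain (x y : vertex T -> R) : realization x -> realization y ->
  chain (T := T) x y (tdist (T := T) x y).
Proof.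
move=> rx ry; have [[inh _] _] := tgraph_tree T; case: inh => o.
have [p [h cx]] := coord_exists o rx; have [q [k cy]] := coord_exists o ry.
by rewrite (tdist_coord cx cy); apply: coord_cdist_chain cx cy.
Qed.

Lemma linear_extension_lipschitz F K x y : linear_extension F ->
  (forall e, pdist (f (src e)) (f (tgt e)) <= K * mlen T e) ->
  pdist (F x) (F y) <= K * pdist x y.
Proof.
move=> [Fv Fe] fK.
suff H u v L : chain (T := T) u v L -> forall (ru : realization u) (rv : realization v),
    pdist (F (exist _ u ru)) (F (exist _ v rv)) <= K * L.
  case: x y => x rx [y ry]; rewrite {2}/pdist /=.
  by apply: H; apply: tdist_chain.
elim=> [{}u|e s s' {}v {}L s01 s'01 _ IH] ru rv.
  by rewrite (Prop_irrelevance ru rv) mulr0 (tm_refl tm).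
have rm : realization (edge_pt (T := T) e s') by right; exists e, s'.
have := IH rm rv; set z := F (exist _ _ rm) => le1.
have h := Fe (exist _ _ ru) e s s01 erefl; have h' := Fe (exist _ _ rm) e s' s'01 erefl.
have := on_segment_dist h h'; have := fK e; rewrite -/z => le2 le3.
apply: le_trans (tm_tri tm _ z _) _; rewrite mulrDr; apply: lerD le1.
by apply: le_trans le3 _; rewrite mulrCA; apply: ler_wpM2l.
Qed.

Lemma lipschitz_extension K :
  (forall e, pdist (f (src e)) (f (tgt e)) <= K * mlen T e) ->
  exists F, equivariant (T := T) (T' := T') F /\ lipschitz_map (T := T) (T' := T') K F.
Proof.
move=> fK; have [F Fl] := linear_extension_exists.
(* The zero function is a default off the realization. *)
exists (fun x => if pselect (realization x) is left rx then sval (F (exist _ x rx))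
                 else fun=> 0).
have E x (rx : realization (T := T) x) :
    (if pselect (realization x) is left rx then sval (F (exist _ x rx)) else fun=> 0)
    = sval (F (exist _ x rx)).
  by case: pselect => // rx'; rewrite (Prop_irrelevance rx rx').
split=> [x rx|x y rx ry]; last first.
  rewrite (E x rx) (E y ry).
  exact: (@linear_extension_lipschitz F K (exist _ x rx) (exist _ y ry)).
split=> [|g]; first by rewrite (E x rx); apply: svalP.
rewrite (E _ (realization_pact g rx)) (E x rx).
rewrite -[RHS]/(sval (tree_point_act g (F (exist _ x rx)))).
rewrite -(linear_extension_act _ _ Fl).
by congr (sval (F _)); apply: eq_exist.
Qed.

End PiecewiseLinear.

(** * From translation lengths to Lipschitz maps *)

Section LipschitzMaps.
Variables (R : realType) (G : groupType) (T T' : metric_tree R G).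
Hypothesis estab_trivial : forall e : edge T', estab e = [set 1%g].
Hypothesis vstab_le : forall v : vertex T, exists w : vertex T',
  forall g, vact g v = v -> vact g w = w.
Variable reps : seq (edge T).
Hypothesis reps_edge : forall e : edge T, exists e0 g, List.In e0 reps /\ e = eact g e0.

Let stab_fixes v : exists y : tree_point T', forall g,
  vact (g0 := T) g v = v -> tree_point_act g y = y.
Proof.
have [w wP] := vstab_le v.
have rw : realization (vertex_pt R w) by left; exists w.
exists (exist _ _ rw) => g /wP gw; apply: eq_exist.
by rewrite /= pact_vertex gw.
Qed.

Lemma vertex_reps : exists l : seq (vertex T),
  forall v, exists u g, List.In u l /\ v = vact g u.
Proof.
have [[inh _] _] := tgraph_tree T; case: inh => o.
(* Any vertex but [o] ends the last dart of a path from [o]; listing [o] itself also covers a tree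
   without edges. *)
exists (o :: app (List.map (@src T) reps) (List.map (@tgt T) reps)) => v.
have := tree_pathP (tgraph_tree T) o v.
case: (lastP (tree_path (tgraph_tree T) o v)) => [|p d].
  by move=> /= ->; exists v, 1%g; rewrite vact1; split=> //; left.
rewrite is_path_rcons => -[_ <-]; have [e0 [g [e0r ed]]] := reps_edge d.1.
rewrite /dart_tgt /dart_src /= ed vact_src vact_tgt.
case: d.2 => /=; [exists (tgt e0), g|exists (src e0), g]; split=> //; right.
  by apply/List.in_app_iff; right; apply/List.in_map_iff; exists e0.
by apply/List.in_app_iff; left; apply/List.in_map_iff; exists e0.
Qed.

Lemma edge_bound_reps (f : vertex T -> tree_point T') K :
  (forall g v, f (vact g v) = tree_point_act g (f v)) ->
  (forall e, List.In e reps -> pdist (f (src e)) (f (tgt e)) <= K * mlen T e) ->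
  forall e, pdist (f (src e)) (f (tgt e)) <= K * mlen T e.
Proof.
move=> fe fK e; have [e0 [g [/fK le0 ->]]] := reps_edge e.
by rewrite vact_src vact_tgt !fe pdist_act len_act.
Qed.

(** Keeps the infimum in [Lambda] from being taken over the empty set. Each orbit representative
    goes to a point fixed by its stabilizer, and edges are extended linearly. *)
Lemma lipschitz_map_exists : exists K, 0 <= K /\
  exists F, equivariant (T := T) (T' := T') F /\ lipschitz_map (T := T) (T' := T') K F.
Proof.
have [[inh _] _] := tgraph_tree T; case: inh => v0.
pose orb (v w : vertex T) := exists g, w = vact g v.
pose pick (P : vertex T -> Prop) : vertex T :=
  if pselect (exists x, P x) is left e then sval (cid e) else v0.
have pickP (P : vertex T -> Prop) x : P x -> P (pick P).
  move=> Px; rewrite /pick; case: pselect => [e|]; last by case; exists x.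
  exact: svalP (cid e).
(* Orbits are equal as predicates, so [pick] selects the same representative along a whole orbit. *)
have orb_act g v : orb (vact g v) = orb v.
  apply/funext => w; apply/propext; split=> -[h ->].
    by exists (h * g)%g; rewrite vactM.
  by exists (h * g^-1)%g; rewrite -vactM mulgVK.
have [y yP] := choice stab_fixes.
have /choice[gam gamP] : forall v, exists g, v = vact g (pick (orb v)).
  move=> v; have [g ->] : orb v (pick (orb v)).
    by apply: (pickP _ v); exists 1%g; rewrite vact1.
  by exists g^-1%g; rewrite -vactM mulVg vact1.
pose f v := tree_point_act (gam v) (y (pick (orb v))).
have fe g v : f (vact g v) = tree_point_act g (f v).
  rewrite /f orb_act -tree_point_actM.
  (* The two group elements carrying [u] to [vact g v] differ by [k] in the stabilizer of [u], which
     fixes the image of [u]. *)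
  set u := pick (orb v); pose k := ((g * gam v)^-1 * gam (vact g v))%g.
  have ku : vact k u = u.
    have := gamP (vact g v); rewrite orb_act -/u => e.
    have e2 : vact g v = vact (g * gam v)%g u by rewrite vactM -gamP.
    by rewrite /k vactM -e e2 -vactM mulVg vact1.
  have -> : gam (vact g v) = (g * gam v * k)%g by rewrite /k mulVKg.
  by rewrite [LHS]tree_point_actM yP.
pose K := \sum_(e <- reps) pdist (f (src e)) (f (tgt e)) / mlen T e.
have K_ge e : 0 <= pdist (f (src e)) (f (tgt e)) / mlen T e.
  by apply: divr_ge0; [apply: (tm_ge0 (tree_metric_pdist T'))|apply/ltW/len_gt0].
exists K; split; first by apply: sumr_ge0.
apply: (lipschitz_extension fe); apply: edge_bound_reps => // e.
rewrite -ler_pdivrMr ?len_gt0 // /K.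
elim: reps => //= e1 r IH [->|/IH le1]; rewrite big_cons.
  by rewrite lerDl; apply: sumr_ge0.
by apply: le_trans le1 _; rewrite lerDr.
Qed.

Lemma lipschitz_map_of_displacement K : 0 <= K ->
  (forall g v, exists y : tree_point T', pdist y (tree_point_act g y) <=
     K * tdist (T := T) (vertex_pt R v) (vertex_pt R (vact g v))) ->
  exists F, equivariant (T := T) (T' := T') F /\ lipschitz_map (T := T) (T' := T') K F.
Proof.
move=> K0 dK; have [l lP] := vertex_reps.
have rv (v : vertex T) : realization (vertex_pt R v) by left; exists v.
pose vp v : tree_point T := exist _ _ (rv v).
pose L v w := K * pdist (vp v) (vp w).
have tm := tree_metric_pdist T; have tm' := tree_metric_pdist T'.
have vp_act g v : vp (vact g v) = tree_point_act g (vp v).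
  by apply: eq_exist; rewrite /= pact_vertex.
have [||||||||||||f [fe fL]] := @equivariant_extension R G (vertex T) (tree_point T')
    (@vact G T) (@tree_point_act R G T') L (@pdist R G T') tm' _ _ _ _ _ _ _ _ _ _ _ _ l
    (List.map (fun e => (src e, tgt e)) reps) lP.
- exact: vact1.
- exact: vactM.
- exact: tree_point_act1.
- exact: tree_point_actM.
- exact: pdist_act.
- by move=> v; rewrite /L (tm_refl tm) mulr0.
- by move=> v w; rewrite /L (tm_sym tm).
- by move=> u v w; rewrite /L -mulrDr ler_wpM2l // (tm_tri tm).
- by move=> g v w; rewrite /L !vp_act pdist_act.
- exact: dK.
- by move=> g y y'; apply: fixed_point_unique.
- exact: stab_fixes.
apply: (lipschitz_extension fe); apply: edge_bound_reps => // e er.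
have := fL (src e, tgt e); rewrite /= List.in_map_iff => h.
apply: le_trans (h _) _; first by exists e.
rewrite /L ler_wpM2l // /pdist /=.
apply: le_trans (_ : `|0 - 1| * mlen T e <= _); last first.
  by rewrite sub0r normrN normr1 mul1r.
apply: ge_inf; first by exists 0 => L' /chain_ge0.
have := @chain_edge _ _ T e 0 1.
rewrite -[edge_pt e 0]/(dart_pt (e, true) 0) -[edge_pt e 1]/(dart_pt (e, true) 1).
by rewrite dart_pt0 dart_pt1 /dart_src /dart_tgt /dart_src /=; apply; lra.
Qed.

End LipschitzMaps.

(** * Finiteness of the quotient graph *)

Section FundamentalGroupPaths.
Variable Y : graph_of_groups.
Implicit Types v w : vertex Y.

Lemma class_cancel v (p q : gpath (base Y) v) (r : gpath v (base Y)) :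
  (class_of (gcat p (ginv q)) * class_of (gcat q r))%g = class_of (gcat p r).
Proof.
rewrite [LHS]pi1_mulE; apply/class_ofP.
rewrite -gcatA; apply: ht_cat; first exact: ht_refl.
by rewrite gcatA; apply: (ht_cat (q := r) (gcatVp q)); apply: ht_refl.
Qed.

(** If [A] and [B] are transported along [p] and [q], the conjugating element is the loop that
    follows [q] and returns along [p]. *)
Lemma conj_factor_conj (j : Defs.factor Y) (A B : set (pi1 Y)) :
  conj_factor j A -> conj_factor j B ->
  exists h, forall x, A x -> B (h * x * h^-1)%g.
Proof.
move=> [p _ <-] [q _ <-]; exists (class_of (gcat q (ginv p))) => x [g _ <-].
exists g => //.
have -> : ((class_of (gcat q (ginv p)))^-1)%g = class_of (gcat p (ginv q)).
  apply: (@mulgI (pi1 Y) (class_of (gcat q (ginv p)))); rewrite mulgV class_cancel.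
  by apply/class_ofP/ht_sym/gcatpV.
have e (r s : gpath (base Y) (sval j)) :
    gcat r (gelt g (ginv s)) = gcat (gcat r (gelt g (gnil _))) (ginv s).
  by rewrite -gcatA.
by rewrite class_cancel (e q p) class_cancel -e.
Qed.

Lemma gpath_exists v : exists p : gpath (base Y) v, True.
Proof.
have [_ /(_ (base Y) v)[p]] := ggraph_connected Y.
elim: p (base Y) => [|d p IH] u /=; first by move=> ->; exists (gnil _).
move=> [<- /IH[q _]]; case: d q => e [] q.
  by exists (gfwd q).
by exists (gbwd q).
Qed.

Definition base_path v : gpath (base Y) v := sval (cid (gpath_exists v)).

(** Closing paths with fixed paths from the base vertex gives a functor from the fundamental
    groupoid to [pi1 Y], so elements of the group can be treated edge by edge. *)
Definition path_class v w (q : gpath v w) : pi1 Y :=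
  class_of (gcat (base_path v) (gcat q (ginv (base_path w)))).

Lemma path_class_cat u v w (q : gpath u v) (r : gpath v w) :
  path_class (gcat q r) = (path_class q * path_class r)%g.
Proof.
by rewrite /path_class (gcatA (base_path u) q (ginv (base_path v))) class_cancel -!gcatA.
Qed.

Lemma path_class_homotopic u v (p q : gpath u v) :
  homotopic p q -> path_class p = path_class q.
Proof.
move=> h; apply/class_ofP; apply: ht_cat; first exact: ht_refl.
by apply: ht_cat => //; apply: ht_refl.
Qed.

Lemma path_class_nil v : path_class (gnil v) = 1%g.
Proof. by apply/class_ofP; apply: gcatpV. Qed.

Lemma path_class_surj (x : pi1 Y) v : exists q : gpath (base Y) v, path_class q = x.
Proof.
exists (gcat (ginv (base_path (base Y))) (gcat (pi1_repr x) (base_path v))).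
rewrite -[RHS]pi1_reprK; apply/class_ofP.
rewrite -!gcatA gcatA; apply: ht_trans (ht_cat (gcatpV _) (ht_refl _)) _.
rewrite /= -[X in homotopic _ X]gcatp1.
by apply: ht_cat (ht_refl _) (gcatpV _).
Qed.

End FundamentalGroupPaths.

Lemma finite_set_list (E : Type) : finite_set [set: E] ->
  exists l : seq E, forall e, List.In e l.
Proof.
move=> /(@finite_seqP {classic E})[s sE]; exists s => e.
have : e \in (s : seq {classic E}) by have : [set: E] e by []; rewrite sE.
elim: (s : seq {classic E}) => //= x r IH.
by rewrite (@in_cons {classic E}) => /orP[/eqP ->|/IH]; auto.
Qed.

Section EdgeOrbits.
Variables (Y : graph_of_groups) (T : gtree (pi1 Y)).
Hypothesis oT : outer_space_tree T.
Let tT : is_tree T := tgraph_tree T.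

Lemma factor_fixes (j : Defs.factor Y) (A : set (pi1 Y)) : conj_factor j A ->
  exists w : vertex T, forall x, A x -> vact x w = w.
Proof.
move=> jA; have [[v jv] _] := ost_factor oT j.
have [h hP] := conj_factor_conj jA jv.
exists (vact h^-1%g v) => x /hP; rewrite /vstab /= => e.
by rewrite -{2}e -!vactM !mulgA mulVg mul1g.
Qed.

Lemma vertex_group_fixes v : exists w : vertex T, forall g : vertex_group v,
  vact (path_class (gelt g (gnil v))) w = w.
Proof.
have [[g gn1]|n1] := pselect (exists g : vertex_group v, g != 1%g).
  pose j : Defs.factor Y := exist _ v (ex_intro _ g gn1).
  have [|w wP] := @factor_fixes j (vertex_subgroup (base_path v)).
    by exists (base_path v).
  by exists w => h; apply: wP; exists h.
have [[inh _] _] := tT; case: inh => w; exists w => g.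
have -> : g = 1%g by apply/eqP; apply: contrapT => /negP ?; apply: n1; exists g.
by rewrite (path_class_homotopic (ht_one _)) path_class_nil vact1.
Qed.

Section Joined.
Variable F : set (edge T).
Hypothesis F_act : forall g e, F e -> F (eact g e).

Definition joined u w := exists p : seq (dart T), is_path u p w /\ uses_only F p.

Lemma uses_only_cat (p q : seq (dart T)) :
  uses_only F (p ++ q) <-> uses_only F p /\ uses_only F q.
Proof. by elim: p => [|d p IH] /=; tauto. Qed.

Lemma uses_only_In (p : seq (dart T)) :
  (forall d, List.In d p -> F d.1) -> uses_only F p.
Proof.
elim: p => //= d p IH h; split; first by apply: h; left.
by apply: IH => d' d'p; apply: h; right.
Qed.

Lemma joined_refl u : joined u u.
Proof. by exists [::]. Qed.

Lemma joined_trans u v w : joined u v -> joined v w -> joined u w.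
Proof.
move=> [p [pv Fp]] [q [qw Fq]]; exists (p ++ q); rewrite is_path_cat uses_only_cat.
by split=> //; exists v.
Qed.

Lemma joined_sym u v : joined u v -> joined v u.
Proof.
move=> [p [pv Fp]]; exists (path_inv p); split; first exact: is_path_rev.
elim: p Fp {pv} => //= d p IH [Fd Fp]; rewrite path_inv_cons -cats1 uses_only_cat.
by split; [apply: IH|].
Qed.

Lemma joined_act g u v : joined u v -> joined (vact g u) (vact g v).
Proof.
move=> [p [pv Fp]]; exists (map (dact g) p); split; first exact: is_path_act.
by elim: p Fp {pv} => //= d p IH [Fd Fp]; split; [apply: F_act|apply: IH].
Qed.

Lemma joined_dart u v p d : is_path u p v -> uses_only F p -> List.In d p ->
  joined u (dart_src d) /\ joined u (dart_tgt d).
Proof.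
elim: p u => //= d' p IH u [du pv] [Fd' Fp].
have j1 : joined u (dart_tgt d') by exists [:: d'].
case=> [<-|/(IH _ pv Fp)[j2 j3]]; last by split; apply: joined_trans j1 _.
by split=> //; rewrite du; apply: joined_refl.
Qed.

End Joined.

(** To each vertex [v] of [Y] belongs a vertex [t v] fixed by its group, to each edge of [Y] a path
    in [T] between the corresponding vertices. The translates of these finitely many paths form a
    connected invariant subgraph, which is all of [T] by minimality. *)
Lemma edge_orbits_finite : exists reps : seq (edge T),
  forall e, exists e0 g, List.In e0 reps /\ e = eact g e0.
Proof.
have [t tP] := choice vertex_group_fixes.
have [es esP] := finite_set_list (ggraph_fin_edge Y).
pose gam (e : edge Y) := path_class (gfwd (gnil (tgt e))).
pose p (e : edge Y) := tree_path tT (t (src e)) (vact (gam e) (t (tgt e))).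
pose reps := List.flat_map (fun e => List.map fst (p e)) es.
pose F : set (edge T) := fun e => exists e0 g, List.In e0 reps /\ e = eact g e0.
exists reps => e.
have F_act g e' : F e' -> F (eact g e').
  by move=> [e0 [h [e0r ->]]]; exists e0, (g * h)%g; rewrite eactM.
have Fp e' : uses_only F (p e').
  apply: uses_only_In => d dp; exists d.1, 1%g; rewrite eact1; split=> //.
  by apply/List.in_flat_map; exists e'; split=> //; apply: List.in_map.
have jp e' : joined F (t (src e')) (vact (gam e') (t (tgt e'))).
  by exists (p e'); split=> //; apply: tree_pathP.
(* Group letters fix [t v] and edge letters follow a translate of some [p e]; since every group
   element is a path class, all translates of all [t u] are joined. *)
have jq u w (q : gpath u w) : joined F (t u) (vact (path_class q) (t w)).
  elim: q => [v|v x g q IH|e' x q IH|e' x q IH].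
  - by rewrite path_class_nil vact1; apply: joined_refl.
  - rewrite (path_class_cat (gelt g (gnil v)) q) vactM -{1}(tP v g).
    exact: joined_act.
  - rewrite (path_class_cat (gfwd (gnil (tgt e'))) q) vactM.
    by apply: joined_trans (jp e') _; apply: joined_act.
  - have -> : path_class (gbwd q) = ((gam e')^-1 * path_class q)%g.
      apply: (canRL (mulKg _)).
      rewrite -(path_class_cat (gfwd (gnil (tgt e')))).
      exact/path_class_homotopic/ht_fwd.
    rewrite vactM; apply: joined_trans (joined_act F_act (gam e')^-1%g IH).
    apply: joined_sym; have := joined_act F_act (gam e')^-1%g (jp e').
    by rewrite -!vactM mulVg vact1.
have jall g u : joined F (t (base Y)) (vact g (t u)).
  by have [q <-] := path_class_surj g u.
pose W : set (vertex T) := fun w => joined F (t (base Y)) w.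
have [] : W = setT /\ F = setT; last by move=> _ FT; have : F e by rewrite FT.
apply: (ost_minimal oT).
- split.
  + by exists (t (base Y)); apply: joined_refl.
  + move=> e' [e0 [g [/List.in_flat_map[e1 [_ /List.in_map_iff[d [<- dp]]]] ->]]].
    have [j1 j2] := joined_dart (tree_pathP _ _ _) (Fp e1) dp.
    have j3 := jall g (src e1).
    have {}j1 := joined_trans j3 (joined_act F_act g j1).
    have {}j2 := joined_trans j3 (joined_act F_act g j2).
    rewrite /W vact_src vact_tgt.
    by move: j1 j2; rewrite /dart_tgt /dart_src /=; case: d.2.
  + by move=> u v ju jv; apply: joined_trans jv; apply: joined_sym.
- by move=> g v jv; apply: joined_trans (jall g _) (joined_act F_act g jv).
- exact: F_act.
Qed.

End EdgeOrbits.

(** * The displacement function *)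

Section Isometries.
Variable R : realType.

Lemma isometric_sym (G : groupType) (T T' : metric_tree R G) :
  equivariantly_isometric T T' -> equivariantly_isometric T' T.
Proof.
move=> [f [fe fs fd]].
have finj x y : realization x -> realization y -> f x = f y -> x = y.
  move=> rx ry e; have := fd x y rx ry; rewrite e.
  have ry' : realization (f y) by have [] := fe y ry.
  rewrite -[LHS]/(pdist (exist _ _ ry') (exist _ _ ry')) (tm_refl (tree_metric_pdist T')).
  rewrite -[RHS]/(pdist (exist _ x rx) (exist _ y ry)) => /esym.
  by move/(tm_eq0 (tree_metric_pdist T))/(congr1 sval).
have /choice[g gP] : forall y : vertex T' -> R, exists x : vertex T -> R,
    realization y -> realization x /\ f x = y.
  move=> y; have [ry|nry] := pselect (realization (T := T') y); last by exists (fun=> 0).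
  by move: ry; rewrite -fs => -[x rx <-]; exists x.
exists g; split.
- move=> y ry; have [rg fg] := gP y ry; split=> // a.
  have [rga fga] := gP _ (realization_pact a ry).
  apply: finj => //; first exact: realization_pact.
  by have [_ ->] := fe (g y) rg; rewrite fga fg.
- apply/seteqP; split=> [_ [y ry <-]|x rx]; first by have [] := gP y ry.
  have [rf _] := fe x rx; have [rg fg] := gP _ rf.
  by exists (f x) => //; apply: finj.
- move=> x y rx ry; have [rg fg] := gP x rx; have [rg' fg'] := gP y ry.
  by rewrite -fd // fg fg'.
Qed.

Lemma lipschitz_transport (G : groupType) (T1 T2 T1' T2' : metric_tree R G)
    (K : R) :
  equivariantly_isometric T1' T1 -> equivariantly_isometric T2 T2' ->
  (exists f, equivariant (T := T1) (T' := T2) f /\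
     lipschitz_map (T := T1) (T' := T2) K f) ->
  exists f, equivariant (T := T1') (T' := T2') f /\
     lipschitz_map (T := T1') (T' := T2') K f.
Proof.
move=> [u [ue _ ud]] [w [we _ wd]] [f [fe fl]]; exists (w \o f \o u).
have ru x : realization x -> realization (u x) by move=> /ue[].
have rf x : realization x -> realization (f x) by move=> /fe[].
split=> [x rx|x y rx ry] /=.
  have [_ e1] := ue x rx; have [_ e2] := fe _ (ru _ rx).
  have [r3 e3] := we _ (rf _ (ru _ rx)); split=> // g.
  by rewrite e1 e2 e3.
by rewrite wd -?ud; [apply: fl|..]; auto.
Qed.

Section Twisting.
Variables (G G' : groupType) (phi : G -> G').
Hypothesis phiM : {morph phi : x y / (x * y)%g}.
Variable T : metric_tree R G'.

Lemma tdist_twist x y : tdist (T := twist phiM T) x y = tdist (T := T) x y.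
Proof.
rewrite /tdist; congr inf; apply/seteqP; split=> L /=.
  elim=> [{}x|e s s' {}y {}L s0 s1 _ IH]; first exact: chain_nil.
  exact: (chain_cons (T := T)).
elim=> [{}x|e s s' {}y {}L s0 s1 _ IH]; first exact: chain_nil.
exact: (chain_cons (T := twist phiM T)).
Qed.

Lemma phiV g : phi g^-1%g = (phi g)^-1%g.
Proof. by apply: (mulgI (phi g)); rewrite -phiM !mulgV (twist_phi1 phiM). Qed.

Lemma pact_twist g (x : vertex T -> R) :
  pact (T := twist phiM T) g x = pact (T := T) (phi g) x.
Proof. by apply/funext => v; rewrite /pact /= phiV. Qed.

End Twisting.

Lemma isometric_twist (G G' : groupType) (phi : G -> G')
    (phiM : {morph phi : x y / (x * y)%g}) (T T' : metric_tree R G') :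
  equivariantly_isometric T T' ->
  equivariantly_isometric (twist phiM T) (twist phiM T').
Proof.
move=> [f [fe fs fd]]; exists f; split=> //.
- move=> x rx; have [rf e] := fe x rx; split=> // g.
  by rewrite !pact_twist e.
- by move=> x y rx ry; rewrite !tdist_twist fd.
Qed.

End Isometries.

(** * Stretching factors and [displacement] *)

Section Displacement.
Variables (R : realType) (k : nat) (Gam : 'I_k -> graph_of_groups).
Variable phi : gog_aut Gam.

Definition admissible (X Z : tree_tuple R Gam) : set R := [set K | 0 <= K /\
  exists f : forall i, (vertex (X i) -> R) -> (vertex (Z i) -> R),
    forall i, equivariant (f i) /\ lipschitz_map K (f i)].

Lemma admissible_componentwise (X Z : tree_tuple R Gam) K : 0 <= K ->
  (forall i, exists f, equivariant (T := X i) (T' := Z i) f /\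
     lipschitz_map (T := X i) (T' := Z i) K f) -> admissible X Z K.
Proof.
move=> K0 H; split=> //; exists (fun i => sval (cid (H i))) => i.
exact: svalP (cid (H i)).
Qed.

Lemma admissible_isometric (X X' Z Z' : tree_tuple R Gam) :
  (forall i, equivariantly_isometric (X' i) (X i)) ->
  (forall i, equivariantly_isometric (Z i) (Z' i)) ->
  admissible X Z `<=` admissible X' Z'.
Proof.
move=> iX iZ K [K0 [f fP]]; apply: admissible_componentwise => // i.
by apply: (lipschitz_transport (iX i) (iZ i)); exists (f i).
Qed.

Variable X : tree_tuple R Gam.
Hypothesis hX : outer_space X.

Definition remetrize (c : edge_lengths X) : tree_tuple R Gam :=
  fun i => MetricTree (c i).

(** Replaces [Z] by the fixed combinatorial trees of [X] with lengths [c], so that one family of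
    edge paths serves the whole simplex. *)
Lemma displacement_lengths c Z : has_edge_lengths c Z ->
  displacement phi Z = displacement phi (remetrize c).
Proof.
move=> cZ; rewrite /displacement /Lambda; congr inf; apply/seteqP; split.
  apply: admissible_isometric => i; first exact: cZ.
  by apply: isometric_twist; apply: isometric_sym; apply: cZ.
apply: admissible_isometric => i; first by apply: isometric_sym; apply: cZ.
by apply: isometric_twist; apply: cZ.
Qed.

Lemma twist_estab i (c : edge_lengths X) (e : edge (aut_act phi (remetrize c) i)) :
  estab e = [set 1%g].
Proof.
apply/seteqP; split=> g /=; last by move=> ->; apply: eact1.
move=> ge; have : estab (e : edge (X (aut_perm phi i))) (@aut_map _ _ phi i g) by [].
rewrite (ost_edge (hX _)) /= => e1.
apply: (bij_inj (@aut_map_bij _ _ phi i)).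
by rewrite e1 (twist_phi1 (@aut_mapM _ _ phi i)).
Qed.

(** A nontrivial vertex stabilizer is a conjugate of a factor, sent by [phi] to a conjugate of a
    factor, and these fix vertices. *)
Lemma twist_vstab i (c : edge_lengths X) (v : vertex (X i)) :
  exists w : vertex (aut_act phi (remetrize c) i),
    forall g, vact g v = v -> vact g w = w.
Proof.
have [[j jv]|v1] := ost_other (hX i) v; last first.
  have [[inh _] _] := tgraph_tree (X (aut_perm phi i)); case: inh => w.
  exists w => g gv; have : vstab v g by [].
  by rewrite v1 /= => ->; apply: (@vact1 _ (aut_act phi (remetrize c) i) w).
have [j' jv'] := aut_map_factor phi jv.
have [w wP] := factor_fixes (hX _) jv'.
by exists w => g gv; apply: wP; exists g.
Qed.

(* den i g is the edge path from v to g v for a vertex v on the axis of g in X i,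
   or v = g v; num i g is its analogue for phi g. Their lengths are the
   translation lengths of g in X and in phi X. *)
Lemma stretching_factors : exists
    (num : forall i, pi1 (Gam i) -> seq (edge (X (aut_perm phi i))))
    (den : forall i, pi1 (Gam i) -> seq (edge (X i))),
  forall c : edge_lengths X,
    (forall K, admissible (remetrize c) (aut_act phi (remetrize c)) K ->
       forall i g, \sum_(e <- num i g) c (aut_perm phi i) e <=
                   K * \sum_(e <- den i g) c i e) /\
    (forall K, 0 <= K ->
       (forall i g, \sum_(e <- num i g) c (aut_perm phi i) e <=
                   K * \sum_(e <- den i g) c i e) ->
       admissible (remetrize c) (aut_act phi (remetrize c)) K).
Proof.
have HD i (g : pi1 (Gam i)) := @minimal_displacement R _ (X i) g.
have HN i (g : pi1 (Gam i)) :=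
  @minimal_displacement R _ (X (aut_perm phi i)) (@aut_map _ _ phi i g).
exists (fun i g => sval (cid (svalP (cid (HN i g))))).
exists (fun i g => sval (cid (svalP (cid (HD i g))))) => c.
have P1 i g := svalP (cid (svalP (cid (HD i g)))) (c i).
have P2 i g := svalP (cid (svalP (cid (HN i g)))) (c (aut_perm phi i)).
have rv i (v : vertex (X i)) : realization (vertex_pt R v : vertex (remetrize c i) -> R).
  by left; exists v.
split=> [K [K0 [f fP]] i g|K K0 H].
  have [d1 _] := P1 i g; have [_ d2] := P2 i g.
  move: d1 d2; set v := sval (cid (HD i g)) => d1 d2.
  have [fe fl] := fP i; rewrite -d1.
  have [rf e] := fe _ (rv i v).
  apply: le_trans (d2 (exist _ _ rf)) _.
  have := fl _ _ (rv i v) (rv i (vact g v)); rewrite /lipschitz_map.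
  rewrite -(pact_vertex (T := remetrize c i)) e.
  rewrite (@tdist_twist R _ _ _ (@aut_mapM _ _ phi i) (remetrize c _)).
  rewrite (@pact_twist R _ _ _ (@aut_mapM _ _ phi i) (remetrize c _)).
  by rewrite (pact_vertex (T := remetrize c i)).
apply: admissible_componentwise => // i.
have [reps repsP] := edge_orbits_finite (hX i).
apply: (@lipschitz_map_of_displacement _ _ (remetrize c i) (aut_act phi (remetrize c) i)
  _ _ reps) => //.
- exact: twist_estab.
- exact: twist_vstab.
move=> g v.
(* The vertex [w] where [phi g] attains its translation length serves: that length is at most [K]
   times the one of [g], which is at most the displacement of [v]. *)
have [_ d1] := P1 i g; have [d2 _] := P2 i g.
move: d2; set w := sval (cid (HN i g)) => d2.
have rw : realization (vertex_pt R w : vertex (aut_act phi (remetrize c) i) -> R).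
  by left; exists w.
exists (exist _ _ rw); rewrite /pdist /=.
rewrite (@tdist_twist R _ _ _ (@aut_mapM _ _ phi i) (remetrize c _)).
rewrite (@pact_twist R _ _ _ (@aut_mapM _ _ phi i) (remetrize c _)).
rewrite (pact_vertex (T := remetrize c _)) [leLHS]d2.
apply: le_trans (H i g) _; rewrite ler_wpM2l //.
apply: le_trans (d1 (exist _ _ (rv i v))) _.
by rewrite /pdist /= (pact_vertex (T := remetrize c i)).
Qed.

Lemma admissible_nonempty (c : edge_lengths X) :
  admissible (remetrize c) (aut_act phi (remetrize c)) !=set0.
Proof.
have H i : exists K, 0 <= K /\ exists f,
    equivariant (T := remetrize c i) (T' := aut_act phi (remetrize c) i) f /\
    lipschitz_map (T := remetrize c i) (T' := aut_act phi (remetrize c) i) K f.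
  have [reps repsP] := edge_orbits_finite (hX i).
  apply: (@lipschitz_map_exists _ _ (remetrize c i)
    (aut_act phi (remetrize c) i) _ reps) => //.
  exact: twist_vstab.
pose K i := sval (cid (H i)).
have [K0 KP] : (forall i, 0 <= K i) /\ forall i, exists f,
    equivariant (T := remetrize c i) (T' := aut_act phi (remetrize c) i) f /\
    lipschitz_map (T := remetrize c i) (T' := aut_act phi (remetrize c) i) (K i) f.
  by split=> i; have [] := svalP (cid (H i)).
exists (\sum_i K i); apply: admissible_componentwise; first exact: sumr_ge0.
move=> i; have [f [fe fl]] := KP i; exists f; split=> // x y rx ry.
apply: le_trans (fl x y rx ry) _; apply: ler_wpM2r.
  exact: (tm_ge0 (tree_metric_pdist (remetrize c i)) (exist _ x rx) (exist _ y ry)).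
by rewrite (bigD1 i) //= lerDl sumr_ge0.
Qed.

(** Carries the criterion from admissible constants to their infimum, so [displacement] is the least
    nonnegative [K] satisfying all the inequalities. *)
Lemma stretching_bounds : exists
    (num : forall i, pi1 (Gam i) -> seq (edge (X (aut_perm phi i))))
    (den : forall i, pi1 (Gam i) -> seq (edge (X i))),
  forall (c : edge_lengths X) (Z : tree_tuple R Gam), has_edge_lengths c Z ->
    [/\ 0 <= displacement phi Z,
      forall i g, \sum_(e <- num i g) c (aut_perm phi i) e <=
                  displacement phi Z * \sum_(e <- den i g) c i e &
      forall K, 0 <= K ->
        (forall i g, \sum_(e <- num i g) c (aut_perm phi i) e <=
                     K * \sum_(e <- den i g) c i e) ->
        displacement phi Z <= K].
Proof.
have [num [den H]] := stretching_factors; exists num, den => c Z cZ.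
rewrite (displacement_lengths cZ) /displacement /Lambda -/(admissible _ _).
have [H1 H2] := H c; have ne := admissible_nonempty c.
have lb0 : lbound (admissible (remetrize c) (aut_act phi (remetrize c))) 0.
  by move=> K [].
split=> [|i g|K K0 /(H2 _ K0) aK].
- exact: lb_le_inf.
- set N := \sum_(e <- num i g) _; set D := \sum_(e <- den i g) _.
  have D0 : 0 <= D by apply: sumr_ge0 => e _; apply/ltW/len_gt0.
  (* For elliptic [g] no division is possible; any one admissible constant already gives
     [N <= 0]. *)
  have [D0'|Dn0] := eqVneq D 0.
    have [K aK] := ne; have := H1 K aK i g; rewrite -/N -/D D0' !mulr0; exact.
  have Dp : 0 < D by rewrite lt_def Dn0.
  rewrite -ler_pdivrMr //; apply: lb_le_inf => // K aK.
  by rewrite ler_pdivrMr //; apply: H1.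
- by apply: ge_inf => //; exists 0.
Qed.

(** Ratios of lengths are constant on the finitely many edge orbits, so their sum bounds them all;
    the added 1 gives [1 <= M]. *)
Lemma lengths_comparable (a b : edge_lengths X) :
  exists M, 1 <= M /\ forall i e, a i e <= M * b i e.
Proof.
have /choice[M MP] : forall i, exists M, 0 <= M /\ forall e, a i e <= M * b i e.
  move=> i; have [reps repsP] := edge_orbits_finite (hX i).
  have ab0 e : 0 <= a i e / b i e by apply: divr_ge0; apply/ltW/len_gt0.
  exists (\sum_(e <- reps) a i e / b i e); split=> [|e]; first exact: sumr_ge0.
  have [e0 [g [e0r ->]]] := repsP e; rewrite !len_act -ler_pdivrMr ?len_gt0 //.
  elim: reps e0r {repsP} => //= e1 r IH [->|/IH le1]; rewrite big_cons.
    by rewrite lerDl; apply: sumr_ge0.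
  by apply: le_trans le1 _; rewrite lerDr.
exists (1 + \sum_i M i); split=> [|i e].
  by rewrite lerDl; apply: sumr_ge0 => i _; have [] := MP i.
have [M0 /(_ e) Me] := MP i; apply: le_trans Me _.
apply: ler_wpM2r; first exact/ltW/len_gt0.
rewrite (bigD1 i) //= addrCA lerDl addr_ge0 // sumr_ge0 // => j _.
by have [] := MP j.
Qed.

End Displacement.

(** * Quasi-convexity and strict decrease away from [A] *)

Theorem lemma6p2 (R : realType) (k : nat) (Gam : 'I_k -> graph_of_groups)
    (Gam_free : forall i, free_group (pi1 (Gam i)))
    (Gam_nontrivial : forall i, nontrivial_group (pi1 (Gam i)))
    (phi : gog_aut Gam)
    (X : tree_tuple R Gam) (hX : outer_space X)
    (A B : tree_tuple R Gam) (hA : open_simplex X A) (hB : open_simplex X B)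
    (z : R -> tree_tuple R Gam) (hz : simplex_segment X A B z) :
  quasi_convex 0 1 (fun t => displacement phi (z t)) /\
  (displacement phi A > displacement phi B ->
   ~ (\forall t \near 0^'+, displacement phi (z t) = displacement phi A)).
Proof.
have [a [b [aA bB zc]]] := hz.
have [num [den sb]] := stretching_bounds phi hX.
pose N t i g := (1 - t) * (\sum_(e <- num i g) a (aut_perm phi i) e) +
                t * (\sum_(e <- num i g) b (aut_perm phi i) e).
pose D t i g := (1 - t) * (\sum_(e <- den i g) a i e) +
                t * (\sum_(e <- den i g) b i e).
(* Along the segment, numerators and denominators are the affine functions [N] and [D] of [t], and
   the displacement is the least [K] with [N <= K * D]. *)
have seg t : 0 <= t <= 1 ->
    [/\ 0 <= displacement phi (z t),
      forall i g, N t i g <= displacement phi (z t) * D t i g &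
      forall K, 0 <= K -> (forall i g, N t i g <= K * D t i g) ->
        displacement phi (z t) <= K].
  move=> /zc[c [cE cz]]; have [l0 l1 l2] := sb c _ cz.
  have eN i g : \sum_(e <- num i g) c (aut_perm phi i) e = N t i g.
    by rewrite /N !mulr_sumr -big_split; apply: eq_bigr => e _; apply: cE.
  have eD i g : \sum_(e <- den i g) c i e = D t i g.
    by rewrite /D !mulr_sumr -big_split; apply: eq_bigr => e _; apply: cE.
  split=> // [i g|K K0 H]; first by rewrite -eN -eD.
  by apply: l2 => // i g; rewrite eN eD.
have D_ge0 t i g : 0 <= t <= 1 -> 0 <= D t i g.
  move=> /andP[t0 t1]; apply: addr_ge0; apply: mulr_ge0 => //; first lra.
    by apply: sumr_ge0 => e _; apply/ltW/len_gt0.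
  by apply: sumr_ge0 => e _; apply/ltW/len_gt0.
split=> [r s r0 rs s1 t /andP[rt ts]|ltBA near0].
  have [|lr0 lr1 _] := seg r; first by apply/andP; split; lra.
  have [|ls0 ls1 _] := seg s; first by apply/andP; split; lra.
  have [|lt0 _ lt2] := seg t; first by apply/andP; split; lra.
  set K := Num.max _ _.
  have Kr : displacement phi (z r) <= K by rewrite le_max lexx.
  have Ks : displacement phi (z s) <= K by rewrite le_max lexx orbT.
  apply: lt2 => [|i g]; first exact: le_trans lr0 Kr.
  have Nr : N r i g <= K * D r i g.
    by apply: le_trans (lr1 i g) _; rewrite ler_wpM2r // D_ge0 //; apply/andP; split; lra.
  have Ns : N s i g <= K * D s i g.
    by apply: le_trans (ls1 i g) _; rewrite ler_wpM2r // D_ge0 //; apply/andP; split; lra.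
  have [ers|nrs] := eqVneq r s; first by have -> : t = r by lra.
  have lrs : 0 < s - r by rewrite subr_gt0 lt_neqAle nrs.
  (* Scaling by [s - r] writes [t] as a combination of [r] and [s] with weights [s - t] and [t - r],
     without division. *)
  rewrite -(ler_pM2l lrs) -subr_ge0.
  have -> : (s - r) * (K * D t i g) - (s - r) * N t i g =
    (s - t) * (K * D r i g - N r i g) + (t - r) * (K * D s i g - N s i g).
    by rewrite /N /D; ring.
  by apply: addr_ge0; apply: mulr_ge0; rewrite subr_ge0.
have [M [M1 MP]] := lengths_comparable hX a b.
have [A0 A1 A2] := sb a _ aA; have [B0 B1 B2] := sb b _ bB.
(* A single interior [t] with the value of [A] suffices for the contradiction. *)
have [t [t0 t1 tA]] : exists t : R, [/\ 0 < t, t < 1 &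
    displacement phi (z t) = displacement phi A].
  near (0 : R)^'+ => t; exists t; split.
  - by near: t; apply: nbhs_right_gt.
  - by near: t; apply: nbhs_right_lt.
  - by near: t.
have [|_ _ lt2] := seg t; first by rewrite !ltW.
set lA := displacement phi A in ltBA tA A0 A1; set lB := displacement phi B in ltBA B0 B1.
(* Mixing the bounds at the ends gives [N <= lA * D - t * (lA - lB) * D_B], where [D_B] is the
   denominator at [B]. Since [D <= M * D_B], the gain is at least [t * (lA - lB) / M] times [D]. *)
suff : lA <= lA - t * (lA - lB) / M.
  by rewrite lerDl oppr_ge0 leNgt divr_gt0 ?mulr_gt0 ?subr_gt0 // (lt_le_trans ltr01).
have M0 : 0 < M by lra.
rewrite -{1}tA; apply: lt2 => [|i g].
  (* The lowered constant must be nonnegative; this follows from [t < 1], [1 <= M] and [0 <= lB]. *)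
  rewrite subr_ge0 ler_pdivrMr //.
  have : lA - lB <= lA * M by nra.
  nra.
have NA := A1 i g; have NB := B1 i g.
have DM : D t i g <= M * \sum_(e <- den i g) b i e.
  rewrite /D !mulr_sumr -big_split; apply: ler_sum => e _ /=.
  have b0 := len_gt0 (b i) e.
  have le1 : 0 <= (1 - t) * (M * b i e - a i e).
    by apply: mulr_ge0; rewrite subr_ge0 ?MP // ltW.
  have le2 : 0 <= t * ((M - 1) * b i e).
    by rewrite !mulr_ge0 ?subr_ge0 // ltW.
  by lra.
have : (lA - lB) * D t i g / M <= (lA - lB) * \sum_(e <- den i g) b i e.
  by rewrite ler_pdivrMr // -mulrA ler_pM2l ?subr_gt0 // mulrC.
have -> : (lA - t * (lA - lB) / M) * D t i g =
    lA * D t i g - t * ((lA - lB) * D t i g / M) by ring.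
move=> /(ler_wpM2l (ltW t0)) le1.
have le2 : (1 - t) * \sum_(e <- num i g) a (aut_perm phi i) e <=
    (1 - t) * (lA * \sum_(e <- den i g) a i e) by apply: ler_wpM2l => //; lra.
have := ler_wpM2l (ltW t0) NB.
by move: le1 le2; rewrite /N /D; lra.
Unshelve. all: by end_near.
Qed.
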